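(* Let $K$ be a field of characteristic $0$, $n\ge 2$, $P_0=K[x_1,\dots,x_n]$, $P=P_0[y_1,\dots,y_n]$ bigraded by $\deg x_i=(1,0)$, $\deg y_i=(0,1)$, and $P_+=(y_1,\dots,y_n)$. Let $r\ge 1$ be an integer and, for $\lambda\in K^n$, let $f_\lambda=\sum_{i=1}^n\lambda_i x_iy_i$. Then there exists a nonempty Zariski open subset $V\subset K^n$ such that for all $\lambda\in V$, with $R=P/f_\lambda^rP$, and all $j\le -n$ the following holds. Let $\beta_i$ be the $i$-th Betti number of the graded $P_0$-module $H^n_{P_+}(R)_j$, so that $\beta_0=\binom{-j-1}{-n-j}$ and $\beta_1=\binom{-j+r-1}{-n-j+r}$. Then $$\beta_i=\frac{-\,r\,(n-1)!\,\beta_0\beta_1}{(i-2)!\,(n-i)!\,(-n-j+r+i-1)\,(n+j-i+1)}\qquad\text{for } 2\le i\le n,$$ and $$e\big(H^n_{P_+}(R)_j\big)=\frac{r\,(-j+r-1)!\,\beta_0}{n!\,(-n-j+r)!}.$$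
   Context: For a bigraded $P$-module $N$, $N_j=\bigoplus_i N_{(i,j)}$ is a graded $P_0$-module with $(N_j)_i=N_{(i,j)}$. $H^n_{P_+}(R)$ is local cohomology with its natural bigrading. The $i$-th Betti number of a finitely generated graded $P_0$-module is the rank of the $i$-th free module in its minimal graded free resolution. $e(M)$ denotes the multiplicity of a finitely generated graded $P_0$-module $M$ (equal to $\dim_K M$ when $M$ has finite length). *)

(* Defs.v *)
From HB Require Import structures.
From mathcomp Require Import all_boot all_order all_algebra.
From mathcomp Require Import boolp classical_sets.
From mathcomp Require Import mpoly.
From mathcomp Require Import zify ring.

Set Implicit Arguments.
Unset Strict Implicit.
Unset Printing Implicit Defensive.

Import Order.TTheory GRing.Theory Num.Theory.

Local Open Scope ring_scope.
Local Open Scope quotient_scope.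

(* Classical predicates are turned into boolean ones with [`[< _ >]] so that  *)
(* MathComp's subtypes and quotients apply to them.                           *)

(** * Quotient modules and restriction of scalars *)

Section SubmodZmod.
Variables (A : nzRingType) (V : lmodType A) (W : submodClosed V).

Definition submod_zmod : {pred V} := fun v => v \in W.

Fact submod_zmod_subproof : zmod_closed submod_zmod.
Proof.
split=> [|u v uW vW]; first exact: (rpred0 W).
by apply: (rpredD (S := W)) => //; rewrite -scaleN1r; apply: (rpredZ (s := W)).
Qed.

HB.instance Definition _ := GRing.isZmodClosed.Build V submod_zmod
  submod_zmod_subproof.

End SubmodZmod.

Definition quotmod (A : nzRingType) (V : lmodType A) (W : submodClosed V) :
  Type := Quotient.quot (submod_zmod W).

Section QuotMod.
Variables (A : nzRingType) (V : lmodType A) (W : submodClosed V).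

Local Notation quotW := (Quotient.quot (submod_zmod W)).

HB.instance Definition _ := GRing.Zmodule.on (quotmod W).

Definition qproj (v : V) : quotmod W := \pi_quotW v.

Definition qscale (a : A) (x : quotmod W) : quotmod W :=
  qproj (a *: repr (x : quotW)).

Lemma qprojP (x : quotmod W) : exists v, x = qproj v.
Proof. by exists (repr (x : quotW)); rewrite /qproj reprK. Qed.

Lemma qproj_eq (u v : V) : (qproj u = qproj v) <-> (u - v \in W).
Proof. rewrite -[u - v \in W]/(u - v \in submod_zmod W) Quotient.idealrBE.
by split=> [|/eqP] // /eqP. Qed.

Lemma qprojD (u v : V) : qproj (u + v) = qproj u + qproj v.
Proof. by rewrite /qproj raddfD. Qed.

Lemma qscaleE a v : qscale a (qproj v) = qproj (a *: v).
Proof.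
apply/qproj_eq; rewrite -scalerBr rpredZ //; apply/qproj_eq.
by rewrite /qproj reprK.
Qed.

Fact qscaleA a b x : qscale a (qscale b x) = qscale (a * b) x.
Proof. by have [v ->] := qprojP x; rewrite !qscaleE scalerA. Qed.
Fact qscale1 : left_id 1 qscale.
Proof. by move=> x; have [v ->] := qprojP x; rewrite !qscaleE scale1r. Qed.
Fact qscaleDr : right_distributive qscale +%R.
Proof.
move=> a x y; have [v ->] := qprojP x; have [w ->] := qprojP y.
by rewrite -qprojD !qscaleE scalerDr qprojD.
Qed.
Fact qscaleDl x : {morph qscale^~ x : a b / a + b}.
Proof.
by move=> a b; have [v ->] := qprojP x; rewrite !qscaleE scalerDl qprojD.
Qed.

HB.instance Definition _ := GRing.Zmodule_isLmodule.Build A (quotmod W)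
  qscaleA qscale1 qscaleDr qscaleDl.

Lemma qprojZ a v : qproj (a *: v) = a *: qproj v.
Proof. by rewrite -qscaleE. Qed.

End QuotMod.

Definition restr (A B : nzRingType) (phi : {rmorphism A -> B})
  (V : lmodType B) : Type := V.

Section Restr.
Variables (A B : nzRingType) (phi : {rmorphism A -> B}) (V : lmodType B).

HB.instance Definition _ := GRing.Zmodule.on (restr phi V).

Definition rscale (a : A) (x : restr phi V) : restr phi V := phi a *: (x : V).

Fact rscaleA a b x : rscale a (rscale b x) = rscale (a * b) x.
Proof. by rewrite /rscale scalerA rmorphM. Qed.
Fact rscale1 : left_id 1 rscale.
Proof. by move=> x; rewrite /rscale rmorph1 scale1r. Qed.
Fact rscaleDr : right_distributive rscale +%R.
Proof. by move=> a x y; rewrite /rscale scalerDr. Qed.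
Fact rscaleDl x : {morph rscale^~ x : a b / a + b}.
Proof. by move=> a b; rewrite /rscale rmorphD scalerDl. Qed.

HB.instance Definition _ := GRing.Zmodule_isLmodule.Build A (restr phi V)
  rscaleA rscale1 rscaleDr rscaleDl.

End Restr.

(** * Localization of a module at the powers of an element *)

Section LocEquiv.
Variables (A : comNzRingType) (M : lmodType A) (s : A).

(* The pair (m, k) stands for the fraction m / s ^+ k. *)
Definition loc_rel (u v : M * nat) : bool :=
  `[< exists t, s ^+ (t + v.2) *: u.1 = s ^+ (t + u.2) *: v.1 >].

Lemma loc_rel_equiv : equiv_class_of loc_rel.
Proof.
split=> [u|u v|v u w].
- by apply/asboolP; exists 0%N.
- by apply/asboolP/asboolP => -[t e]; exists t.
- move=> /asboolP[t e] /asboolP[t' e']; apply/asboolP.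
  exists (t + t' + v.2)%N.
  transitivity (s ^+ (t' + w.2) *: (s ^+ (t + v.2) *: u.1)).
    by rewrite scalerA -exprD; congr (_ ^+ _ *: _); lia.
  rewrite e scalerA -exprD.
  transitivity (s ^+ (t + u.2) *: (s ^+ (t' + w.2) *: v.1)).
    by rewrite scalerA -exprD; congr (_ ^+ _ *: _); lia.
  by rewrite e' scalerA -exprD; congr (_ ^+ _ *: _); lia.
Qed.

Canonical loc_rel_equivRel := EquivRelPack loc_rel_equiv.
Canonical loc_rel_encModRel := defaultEncModRel loc_rel.

Definition loc : Type := {eq_quot loc_rel}.
HB.instance Definition _ := Choice.on loc.

Definition frac (m : M) (k : nat) : loc := \pi_{eq_quot loc_rel} (m, k).
Definition num (x : loc) : M := (repr (x : {eq_quot loc_rel})).1.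
Definition den (x : loc) : nat := (repr (x : {eq_quot loc_rel})).2.

End LocEquiv.

Section LocTheory.
Variables (A : comNzRingType) (M : lmodType A) (s : A).
Local Notation loc := (loc M s).
Local Notation frac := (@frac A M s).

Lemma fracK (x : loc) : frac (num x) (den x) = x.
Proof. by rewrite /frac -surjective_pairing reprK. Qed.

Lemma frac_eq m k m' k' : frac m k = frac m' k' <->
  exists t, s ^+ (t + k') *: m = s ^+ (t + k) *: m'.
Proof.
split=> [/eqmodP/asboolP//|h].
by apply/eqmodP/asboolP.
Qed.

Lemma frac_numden m k :
  exists t, s ^+ (t + k) *: num (frac m k) = s ^+ (t + den (frac m k)) *: m.
Proof. by apply/frac_eq; rewrite fracK. Qed.

Definition loc_add (x y : loc) : loc :=
  frac (s ^+ den y *: num x + s ^+ den x *: num y) (den x + den y).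
Definition loc_opp (x : loc) : loc := frac (- num x) (den x).
Definition loc_scale (a : A) (x : loc) : loc := frac (a *: num x) (den x).

Lemma loc_addE m k m' k' :
  loc_add (frac m k) (frac m' k') = frac (s ^+ k' *: m + s ^+ k *: m') (k + k').
Proof.
have [t e] := frac_numden m k; have [t' e'] := frac_numden m' k'.
apply/frac_eq; exists (t + t')%N.
rewrite !scalerDr !scalerA -!exprD; congr (_ + _).
  rewrite (_ : (_ + _)%N = (t' + k' + den (frac m' k') + (t + k))%N); last lia.
  rewrite exprD -scalerA e scalerA -exprD.
  by congr (_ ^+ _ *: _); lia.
rewrite (_ : (_ + _)%N = (t + k + den (frac m k) + (t' + k'))%N); last lia.
rewrite exprD -scalerA e' scalerA -exprD.
by congr (_ ^+ _ *: _); lia.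
Qed.

Lemma loc_scaleE a m k : loc_scale a (frac m k) = frac (a *: m) k.
Proof.
have [t e] := frac_numden m k; apply/frac_eq; exists t.
by rewrite !scalerA ![_ * a]mulrC -!scalerA e.
Qed.

Lemma loc_oppE m k : loc_opp (frac m k) = frac (- m) k.
Proof. by rewrite -scaleN1r -loc_scaleE /loc_scale scaleN1r. Qed.

Lemma fracP (x : loc) : exists m k, x = frac m k.
Proof. by exists (num x), (den x); rewrite fracK. Qed.

Fact loc_addA : associative loc_add.
Proof.
move=> x y z; have [m [k ->]] := fracP x; have [m' [k' ->]] := fracP y.
have [m'' [k'' ->]] := fracP z; rewrite !loc_addE addnA.
rewrite !scalerDr !scalerA -!exprD addrA.
by rewrite (addnC k'' k') (addnC k k'') (addnC k k').
Qed.
Fact loc_addC : commutative loc_add.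
Proof.
move=> x y; have [m [k ->]] := fracP x; have [m' [k' ->]] := fracP y.
by rewrite !loc_addE addrC addnC.
Qed.
Fact loc_add0 : left_id (frac 0 0) loc_add.
Proof.
move=> x; have [m [k ->]] := fracP x.
by rewrite loc_addE scaler0 expr0 scale1r add0r.
Qed.
Fact loc_addN : left_inverse (frac 0 0) loc_opp loc_add.
Proof.
move=> x; have [m [k ->]] := fracP x; rewrite loc_oppE loc_addE.
by rewrite -scalerDr addNr scaler0; apply/frac_eq; exists 0%N; rewrite !scaler0.
Qed.

HB.instance Definition _ := GRing.isZmodule.Build loc
  loc_addA loc_addC loc_add0 loc_addN.

Lemma fracD m k m' k' :
  frac m k + frac m' k' = frac (s ^+ k' *: m + s ^+ k *: m') (k + k').
Proof. exact: loc_addE. Qed.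

Fact loc_scaleA a b x : loc_scale a (loc_scale b x) = loc_scale (a * b) x.
Proof. by have [m [k ->]] := fracP x; rewrite !loc_scaleE scalerA. Qed.
Fact loc_scale1 : left_id 1 loc_scale.
Proof.
by move=> x; have [m [k ->]] := fracP x; rewrite !loc_scaleE scale1r.
Qed.
Fact loc_scaleDr : right_distributive loc_scale +%R.
Proof.
move=> a x y; have [m [k ->]] := fracP x; have [m' [k' ->]] := fracP y.
rewrite fracD !loc_scaleE fracD scalerDr !scalerA.
by rewrite ![a * _]mulrC.
Qed.
Fact loc_scaleDl x : {morph loc_scale^~ x : a b / a + b}.
Proof.
move=> a b; have [m [k ->]] := fracP x; rewrite !loc_scaleE fracD.
by apply/frac_eq; exists 0%N; rewrite -scalerDr -scalerDl [RHS]scalerA -exprD.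
Qed.

HB.instance Definition _ := GRing.Zmodule_isLmodule.Build A loc
  loc_scaleA loc_scale1 loc_scaleDr loc_scaleDl.

Lemma fracZ a m k : a *: frac m k = frac (a *: m) k.
Proof. exact: loc_scaleE. Qed.

End LocTheory.

Section LocMap.
Variables (A : comNzRingType) (M : lmodType A) (s u t : A).

(* The localization map M_s -> M_t when t = s * u. *)
Definition locmap (x : loc M s) : loc M t :=
  frac t (u ^+ den x *: num x) (den x).

Hypothesis tE : t = s * u.

Lemma locmapE m k : locmap (frac s m k) = frac t (u ^+ k *: m) k.
Proof.
have [a e] := frac_numden s m k; apply/frac_eq; exists a.
rewrite tE !exprMn !scalerA -!mulrA -!exprD.
rewrite (_ : a + k + _ = a + den (frac s m k) + k)%N; last lia.
by rewrite ![s ^+ _ * _]mulrC -!scalerA e.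
Qed.

Lemma locmap_linear : linear locmap.
Proof.
move=> a x y; have [m [k ->]] := fracP x; have [m' [k' ->]] := fracP y.
rewrite fracZ fracD !locmapE fracZ fracD; congr (frac _ _ _).
rewrite scalerDr !scalerA tE !exprMn !exprD.
by congr (_ *: _ + _ *: _); ring.
Qed.

End LocMap.

(** * The Cech complex of a module with respect to y_0, ..., y_(n-1) *)

(* Over a noetherian ring its k-th cohomology is the k-th local cohomology of *)
(* M with support in the ideal (y_0, ..., y_(n-1)).                           *)

Section Cech.
Variables (A : comNzRingType) (M : lmodType A) (n : nat) (y : 'I_n -> A).

Definition yprod (S : {set 'I_n}) : A := \prod_(i in S) y i.

(* All degrees at once: the degree k part consists of the families supported  *)
(* on the S with #|S| = k.                                                    *)
Definition cochain : Type := forall S : {set 'I_n}, loc M (yprod S).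

HB.instance Definition _ := gen_eqMixin cochain.
HB.instance Definition _ := gen_choiceMixin cochain.

Definition cochain_zero : cochain := fun S => 0.
Definition cochain_opp (c : cochain) : cochain := fun S => - c S.
Definition cochain_add (c d : cochain) : cochain := fun S => c S + d S.
Definition cochain_scale (a : A) (c : cochain) : cochain := fun S => a *: c S.

Fact cochain_addA : associative cochain_add.
Proof. by move=> c d e; apply: functional_extensionality_dep => S; apply: addrA. Qed.
Fact cochain_addC : commutative cochain_add.
Proof. by move=> c d; apply: functional_extensionality_dep => S; apply: addrC. Qed.
Fact cochain_add0 : left_id cochain_zero cochain_add.
Proof. by move=> c; apply: functional_extensionality_dep => S; apply: add0r. Qed.
Fact cochain_addN : left_inverse cochain_zero cochain_opp cochain_add.
Proof. by move=> c; apply: functional_extensionality_dep => S; apply: addNr. Qed.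
HB.instance Definition _ := GRing.isZmodule.Build cochain
  cochain_addA cochain_addC cochain_add0 cochain_addN.

Fact cochain_scaleA a b c :
  cochain_scale a (cochain_scale b c) = cochain_scale (a * b) c.
Proof. by apply: functional_extensionality_dep => S; apply: scalerA. Qed.
Fact cochain_scale1 : left_id 1 cochain_scale.
Proof. by move=> c; apply: functional_extensionality_dep => S; apply: scale1r. Qed.
Fact cochain_scaleDr : right_distributive cochain_scale +%R.
Proof.
by move=> a c d; apply: functional_extensionality_dep => S; apply: scalerDr.
Qed.
Fact cochain_scaleDl c : {morph cochain_scale^~ c : a b / a + b}.
Proof.
by move=> a b; apply: functional_extensionality_dep => S; apply: scalerDl.
Qed.
HB.instance Definition _ := GRing.Zmodule_isLmodule.Build A cochain
  cochain_scaleA cochain_scale1 cochain_scaleDr cochain_scaleDl.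

Definition cech_diff (c : cochain) : cochain := fun T =>
  \sum_(i in T) (-1) ^+ #|[set j in T | (j < i)%N]| *:
    locmap (y i) (yprod T) (c (T :\ i)).

Lemma yprodD1 (T : {set 'I_n}) i : i \in T -> yprod T = yprod (T :\ i) * y i.
Proof. by move=> iT; rewrite /yprod (big_setD1 i) //= mulrC. Qed.

Lemma cech_diff_linear : linear cech_diff.
Proof.
move=> a c d; apply: functional_extensionality_dep => T.
rewrite /cech_diff.
have -> : (a *: cech_diff c + cech_diff d) T =
  a *: cech_diff c T + cech_diff d T by [].
rewrite scaler_sumr -big_split /=; apply: eq_bigr => i iT.
have -> : (a *: c + d) (T :\ i) = a *: c (T :\ i) + d (T :\ i) by [].
by rewrite (locmap_linear (yprodD1 iT)) scalerDr !scalerA [_ * a]mulrC.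
Qed.

HB.instance Definition _ := GRing.isLinear.Build A cochain cochain _ cech_diff
  cech_diff_linear.

Section Degree.
Variable k : nat.

Definition cocycle_pred (c : cochain) : bool :=
  `[< (forall S : {set 'I_n}, #|S| != k -> c S = 0) /\ cech_diff c = 0 >].

Fact cocycle_submod : submod_closed cocycle_pred.
Proof.
split=> [|a c d /asboolP[c0 dc] /asboolP[d0 dd]]; apply/asboolP.
  by split; rewrite ?linear0.
split=> [S Sk|]; last by rewrite cech_diff_linear dc dd scaler0 addr0.
by have -> : (a *: c + d) S = a *: c S + d S by []; rewrite c0 ?d0 // scaler0 addr0.
Qed.

HB.instance Definition _ := GRing.isSubmodClosed.Build A cochain cocycle_pred
  cocycle_submod.

Record cocycle := Cocycle { cocycle_val :> cochain; _ : cocycle_pred cocycle_val }.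
HB.instance Definition _ := [isSub for cocycle_val].
HB.instance Definition _ := [Choice of cocycle by <:].
HB.instance Definition _ := [SubChoice_isSubLmodule of cocycle by <:].

Definition coboundary (z : cocycle) : bool :=
  `[< exists2 b : cochain, (forall S : {set 'I_n}, #|S|.+1 != k -> b S = 0) &
        cech_diff b = val z >].

Fact coboundary_submod : submod_closed coboundary.
Proof.
split=> [|a z z' /asboolP[b b0 db] /asboolP[b' b0' db']]; apply/asboolP.
  by exists 0 => //; rewrite linear0.
exists (a *: b + b'); last by rewrite cech_diff_linear db db'.
move=> S Sk.
by have -> : (a *: b + b') S = a *: b S + b' S by []; rewrite b0 ?b0' // scaler0 addr0.
Qed.

HB.instance Definition _ := GRing.isSubmodClosed.Build A cocycle coboundary
  coboundary_submod.

Definition cech_cohomology : Type :=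
  quotmod (GRing.SubmodClosed.clone A cocycle coboundary _).
HB.instance Definition _ := GRing.Lmodule.on cech_cohomology.

End Degree.
End Cech.

(** * Graded modules over a polynomial ring *)

(* p is homogeneous of degree i, where i may be negative *)
Definition homz (A : nzRingType) (n : nat) (i : int) (p : {mpoly A[n]}) : bool :=
  if i is Posz d then p \is d.-homog else p == 0.

Section Homz.
Variables (A : comNzRingType) (n : nat).
Implicit Types (i j : int) (p q : {mpoly A[n]}).

Lemma homz0 i : homz i (0 : {mpoly A[n]}).
Proof. by case: i => d /=; rewrite ?rpred0. Qed.

Lemma homzD i p q : homz i p -> homz i q -> homz i (p + q).
Proof.
by case: i => d /=; [exact: rpredD | move=> /eqP-> /eqP->; rewrite addr0].
Qed.

Lemma homzM i j p q : homz i p -> homz j q -> homz (i + j) (p * q).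
Proof.
case: i => i /=; last by move=> /eqP-> _; rewrite mul0r homz0.
case: j => j /=; last by move=> _ /eqP->; rewrite mulr0 homz0.
exact: dhomogM.
Qed.

End Homz.

(* A module with its family of homogeneous parts; that M is their direct sum  *)
(* is not recorded, as no definition below refers to it.                      *)
Record gradedModule (A : nzRingType) := GradedModule {
  gcarrier :> lmodType A;
  gpart : int -> set gcarrier
}.

(* The k-th free module is the sum of the A(- fshift k t), t < frank k,       *)
(* written as row vectors; the t-th basis vector has degree [fshift k t] and  *)
(* the differentials act by v |-> v *m fdiff k.                               *)
Record gradedFreeResolution (K : fieldType) (n : nat)
    (M : gradedModule {mpoly K[n]}) := GradedFreeResolution {
  frank : nat -> nat;
  fshift : forall k, 'I_(frank k) -> int;
  fdiff : forall k, 'M[{mpoly K[n]}]_(frank k.+1, frank k);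
  faug : {linear 'rV[{mpoly K[n]}]_(frank 0) -> M};
  fdiff_homog : forall k s t, homz (fshift s - fshift t) (fdiff k s t);
  faug_homog : forall t, gpart (fshift t) (faug (delta_mx 0 t));
  faug_surj : forall x : M, exists v, faug v = x;
  faug_exact : forall v, faug v = 0 <-> exists w, v = w *m fdiff 0;
  fdiff_exact : forall k (v : 'rV_(frank k.+1)),
    v *m fdiff k = 0 <-> exists w, v = w *m fdiff k.+1
}.

(* The image of each differential lies in (x_1, ..., x_n) F. *)
Definition minimal_resolution (K : fieldType) (n : nat)
    (M : gradedModule {mpoly K[n]}) (F : gradedFreeResolution M) : Prop :=
  forall k s t, (fdiff F k s t)@_0%MM = 0.

(* 0 if M has no minimal graded free resolution by modules of finite rank,    *)
(* i.e. if M is not finitely generated.                                       *)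
Definition betti (K : fieldType) (n : nat) (M : gradedModule {mpoly K[n]})
    (i : nat) : nat :=
  xget 0%N [set b | exists2 F : gradedFreeResolution M,
    minimal_resolution F & b = frank F i].

Definition has_dim (K : fieldType) (n : nat) (M : lmodType {mpoly K[n]})
    (U : set M) (d : nat) : Prop :=
  exists b : 'I_d -> M,
    [/\ forall t, U (b t),
        forall c : 'I_d -> K,
          \sum_t (c t)%:MP_[n] *: b t = 0 -> forall t, c t = 0
      & forall x, U x -> exists c : 'I_d -> K, x = \sum_t (c t)%:MP_[n] *: b t].

(* For M finitely generated, p has degree dim M - 1 when it is not 0, and it  *)
(* is 0 exactly when M has finite length.                                     *)
Definition hilbert_polynomial (K : fieldType) (n : nat)
    (M : gradedModule {mpoly K[n]}) (p : {poly rat}) : Prop :=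
  exists i0 : int, forall i : int, i0 <= i ->
    exists2 d, has_dim (@gpart _ M i) d & d%:R = p.[i%:~R].

Definition is_multiplicity (K : fieldType) (n : nat)
    (M : gradedModule {mpoly K[n]}) (e : rat) : Prop :=
  exists2 p, hilbert_polynomial M p &
    if p == 0 then exists2 d, has_dim [set: M] d & e = d%:R
    else e = ((size p).-1)`!%:R * lead_coef p.

Definition multiplicity (K : fieldType) (n : nat)
    (M : gradedModule {mpoly K[n]}) : rat :=
  xget 0 [set e | is_multiplicity M e].

(** * Bigraded modules over P = K[x_1, ..., x_n][y_1, ..., y_n] *)

Section Bigraded.
Variables (K : fieldType) (n : nat).

Local Notation P0 := {mpoly K[n]}.
Local Notation P := {mpoly P0[n]}.

Definition bihomog (a b : int) (p : P) : Prop :=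
  homz b p /\ forall m, homz a p@_m.

(* As above, only the compatibility of the parts with the action is recorded. *)
Record bigradedModule := BigradedModule {
  bcarrier :> lmodType P;
  bipart : int -> int -> set bcarrier;
  bipartZ : forall (a b c d : int) p (x : bcarrier), bihomog a b p ->
    bipart c d x -> bipart (a + c) (b + d) (p *: x)
}.

(** The graded P0-module N_j: sums of elements of the N_(i, j), i : int *)

Section Component.
Variables (N : bigradedModule) (j : int).

Local Notation N0 := (restr (@mpolyC n P0) N).

Definition component_pred (x : N0) : bool :=
  `[< exists2 s : seq N, (forall z, z \in s -> exists i, bipart i j z) &
        x = \sum_(z <- s) z >].

Lemma component_submod : submod_closed component_pred.
Proof.
have add x y : component_pred x -> component_pred y -> component_pred (x + y).
  move=> /asboolP[s sh ->] /asboolP[t th ->]; apply/asboolP; exists (s ++ t).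
    by move=> z; rewrite mem_cat => /orP[/sh|/th].
  by rewrite big_cat.
have zero : component_pred 0.
  by apply/asboolP; exists [::] => //; rewrite big_nil.
split=> // a x y xj yj; apply: (add) => //.
move: xj => /asboolP[s sh ->]; rewrite scaler_sumr big_seq.
elim/big_ind: _; [exact: zero | exact: add |] => z /sh[i zi].
change (component_pred (a%:MP *: (z : bcarrier N))).
rewrite (pihomog_partitionE (p := a) (leqnn (mmeasure mdeg a))).
rewrite raddf_sum /= scaler_suml.
elim/big_ind: _; [exact: zero | exact: add |] => d _; apply/asboolP.
exists [:: (pihomog mdeg d a)%:MP *: z]; last by rewrite big_seq1.
move=> _ /[!inE] /eqP->; exists (d%:Z + i); rewrite -[j]add0r.
apply: bipartZ zi; split.
  apply/dhomogP => m; rewrite msuppC; case: ifP => //= _ /[!inE] /eqP->.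
  exact: mdeg0.
move=> m; rewrite mcoeffC; case: eqP => _; rewrite /= ?mulr1 ?pihomogP //.
by rewrite mulr0 rpred0.
Qed.

HB.instance Definition _ := GRing.isSubmodClosed.Build P0 N0 component_pred
  component_submod.

Record component :=
  Component { component_val :> N0; _ : component_pred component_val }.
HB.instance Definition _ := [isSub for component_val].
HB.instance Definition _ := [Choice of component by <:].
HB.instance Definition _ := [SubChoice_isSubLmodule of component by <:].

Definition graded_component : gradedModule P0 :=
  @GradedModule P0 component
    (fun i => [set x : component | bipart i j (component_val x : N)]%classic).

End Component.

(** Local cohomology with respect to P_+ = (y_1, ..., y_n) *)

Definition yvar (i : 'I_n) : P := 'X_i.

Section LocalCohomology.
Variables (N : bigradedModule) (k : nat).

(* The y_i have degree (0, 1), so a fraction x / y_S ^+ t with x in           *)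
(* N_(a, b + t * #|S|) has degree (a, b).                                     *)
Definition cochain_part (a b : int) (c : cochain N yvar) : Prop :=
  forall S : {set 'I_n}, exists t x,
    bipart a (b + (t * #|S|)%:Z) x /\ c S = frac (yprod yvar S) x t.

Definition cech_part (a b : int) : set (cech_cohomology N yvar k) :=
  [set h | exists2 z : cocycle N yvar k, cochain_part a b z & h = qproj _ z].

Lemma cech_partZ (a b c d : int) p (h : cech_cohomology N yvar k) :
  bihomog a b p -> cech_part c d h -> cech_part (a + c) (b + d) (p *: h).
Proof.
move=> pab [z zcd ->]; exists (p *: z); last by rewrite qprojZ.
move=> S; have [t [x [xcd zS]]] := zcd S; exists t, (p *: x).
split; first by rewrite -addrA; apply: bipartZ.
by rewrite -fracZ -zS.
Qed.

Definition local_cohomology : bigradedModule := BigradedModule cech_partZ.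

End LocalCohomology.

(** The bigraded module P / g P *)

Section CyclicModule.
Variable g : P.

Definition principal_pred (p : P^o) : bool := `[< exists q : P, p = q * g >].

Fact principal_submod : submod_closed principal_pred.
Proof.
split=> [|a x y /asboolP[p ->] /asboolP[q ->]]; apply/asboolP.
  by exists 0; rewrite mul0r.
by exists (a * p + q); rewrite mulrDl -mulrA.
Qed.

HB.instance Definition _ := GRing.isSubmodClosed.Build P P^o principal_pred
  principal_submod.

Definition cyclic_carrier : lmodType P :=
  quotmod (GRing.SubmodClosed.clone P P^o principal_pred _).

Definition cyclic_part (a b : int) : set cyclic_carrier :=
  [set x | exists2 p : P, bihomog a b p & x = qproj _ (p : P^o)].

Lemma bihomogM a b c d p q :
  bihomog a b p -> bihomog c d q -> bihomog (a + c) (b + d) (p * q).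
Proof.
move=> [pb pa] [qd qc]; split=> [|m]; first exact: homzM.
rewrite mcoeffM; elim/big_ind: _ => [|u v|u _]; first exact: homz0.
  exact: homzD.
exact: homzM.
Qed.

Lemma cyclic_partZ (a b c d : int) p (x : cyclic_carrier) :
  bihomog a b p -> cyclic_part c d x -> cyclic_part (a + c) (b + d) (p *: x).
Proof.
move=> pab [q qcd ->]; exists (p * q); first exact: bihomogM.
by rewrite -qprojZ.
Qed.

Definition cyclic_module : bigradedModule := BigradedModule cyclic_partZ.

End CyclicModule.

Definition flambda (l : 'I_n -> K) : P := \sum_i (l i *: 'X_i)%:MP * 'X_i.

End Bigraded.

Definition zariski_open (K : fieldType) (n : nat) (V : set ('I_n -> K)) : Prop :=
  exists E : set {mpoly K[n]},
    forall l, V l <-> exists2 p, E p & p.@[l] != 0.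

(* Main.v *)
From HB Require Import structures.
Require Import Defs.
From mathcomp Require Import all_boot all_order all_algebra.
From mathcomp Require Import boolp classical_sets functions.
From mathcomp Require Import mpoly.
From mathcomp Require Import zify ring.

Set Implicit Arguments.
Unset Strict Implicit.
Unset Printing Implicit Defensive.

Import Order.TTheory GRing.Theory Num.Theory.

Local Open Scope ring_scope.

(** Let S = P_0. The module H^n_{P_+}(P) is the module of inverse polynomials, which
    is S-free on the y^(-a-1). In degree j = - n - d it has rank 'C(d+n-1, d), and
    right exactness of H^n_{P_+} presents H^n_{P_+}(R)_j as the cokernel M of
    multiplication by f^r, a map S(-r)^'C(d+r+n-1, d+r) -> S^'C(d+n-1, d). This is
    proved on Cech cochains: a fraction of the right degree is determined by its
    polar part ([cls_residue]), so that the kernel of the augmentation is the row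
    space of the presentation matrix ([aug_eq0]).

    The open set V is the complement of the coordinate hyperplanes. There
    multiplication by f is the raising operator of an sl_2: it is the polarization
    operator E = sum_i l_i x_i y_i, and its partner is F = sum_i l_i^-1 z_i d/dx_i,
    where z_i is dual to y_i. The weight is the degree in x minus the degree in z, and
    representation theory of sl_2 in characteristic 0 shows that E^r is injective
    on the vectors of degree at most d and surjective onto those of degree at least
    d + r ([presentation_inj], [presentation_surj]). So M has finite length,
    vanishes in degrees at least d + r, and the presentation matrix has no syzygy of
    degree at most d + r.

    These two bounds leave one possible degree for each higher syzygy. In terms of
    Koszul homology, they say that the kernel of the presentation has its homology
    in one strand ([first_strand]), a property inherited by the syzygies of its
    minimal generators ([strand_step]). Choosing K-bases of the lowest degree parts
    therefore builds a minimal resolution, and it is pure with shifts 0, r, d+r+1,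
    d+r+2 and so on. Ranks of minimal resolutions are unique ([betti_minimal]).

    The vanishing of M in degrees at least d + r is a system of linear equations on
    the Betti numbers. It says that sum_i (-1)^i b_i q(c_i) = 0 for all polynomials
    q of degree less than n, where c_i is the i-th shift, and choosing q with zeros
    at all the c_k except c_0 and c_i gives b_i ([pure_betti]). Since M has finite
    length its multiplicity is its length, which the presentation, cut at degree
    d + r, expresses by binomial coefficients ([length_component]). *)

(** * Dimension of K-subspaces of modules over a polynomial ring *)

(** This turns a subspace given by a predicate into a matrix, so that Gaussian
    elimination applies to it; a matrix of maximal rank among those whose row
    space lies in the subspace will do. *)
Lemma row_subspace (K : fieldType) (a : nat) (P : set 'rV[K]_a) :
  P 0 -> (forall (c : K) u v, P u -> P v -> P (c *: u + v)) ->
  exists B : 'M[K]_a, forall c, P c <-> (c <= B)%MS.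
Proof.
move=> P0 PD.
pose good k := `[< exists2 B : 'M[K]_a, \rank B = k & forall c, (c <= B)%MS -> P c >].
have ex : exists k, good k.
  exists 0%N; apply/asboolP; exists 0; first exact: mxrank0.
  by move=> c; rewrite submx0 => /eqP->.
have bnd k : good k -> (k <= a)%N by move=> /asboolP[B <- _]; exact: rank_leq_row.
case: (ex_maxnP ex bnd) => k /asboolP[B rB PB] maxk.
exists B => c; split=> [Pc|/PB //]; apply/contraT => ncB.
have : good (\rank (B + c)%MS).
  apply/asboolP; exists (B + c)%MS => // w /sub_addsmxP[[u v] /= ->].
  rewrite addrC [v]mx11_scalar mul_scalar_mx; apply: PD => //.
  by apply: PB; exact: submxMl.
move=> /maxk; rewrite -rB leqNgt ltn_neqAle mxrankS ?addsmxSl // andbT.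
rewrite negbK eq_sym => /eqP e; case/negP: ncB.
apply: submx_trans (addsmxSr B c) _.
by rewrite -(geq_leqif (mxrank_leqif_sup (addsmxSl B c))) e.
Qed.

Section Dimension.
Variables (K : fieldType) (n : nat).
Local Notation S := {mpoly K[n]}.
Implicit Types (V W : lmodType S).

Definition lincomb V d (b : 'I_d -> V) (c : 'rV[K]_d) : V :=
  \sum_t (c 0 t)%:MP_[n] *: b t.

Lemma lincombZD V d (b : 'I_d -> V) (a : K) u v :
  lincomb b (a *: u + v) = a%:MP_[n] *: lincomb b u + lincomb b v.
Proof.
rewrite /lincomb scaler_sumr -big_split; apply: eq_bigr => t _ /=.
by rewrite !mxE mpolyCD mpolyCM scalerDl scalerA.
Qed.

Lemma lincomb0 V d (b : 'I_d -> V) : lincomb b 0 = 0.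
Proof. by rewrite /lincomb big1 // => t _; rewrite mxE scale0r. Qed.

Lemma lincombM V d e (b : 'I_d -> V) (A : 'M[K]_(e, d)) (c : 'rV[K]_e) :
  lincomb b (c *m A) = lincomb (fun t => lincomb b (row t A)) c.
Proof.
rewrite /lincomb; under [RHS]eq_bigr do rewrite scaler_sumr.
rewrite exchange_big; apply: eq_bigr => t _ /=.
rewrite mxE raddf_sum /= scaler_suml; apply: eq_bigr => s _.
by rewrite !mxE scalerA mpolyCM.
Qed.

Lemma lincomb_linear V W (f : {linear V -> W}) d (b : 'I_d -> V) c :
  f (lincomb b c) = lincomb (f \o b) c.
Proof. by rewrite linear_sum; apply: eq_bigr => t _; rewrite linearZ. Qed.

Lemma eq_lincomb V d (b b' : 'I_d -> V) c : b =1 b' -> lincomb b c = lincomb b' c.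
Proof. by move=> e; apply: eq_bigr => t _; rewrite e. Qed.

(** Scalars are constant polynomials: the modules at hand carry only their
    structure over the polynomial ring. *)
Definition ksubspace V (U : set V) :=
  U 0 /\ forall (c : K) u v, U u -> U v -> U (c%:MP_[n] *: u + v).

Lemma ksubspace_lincomb V (U : set V) d (b : 'I_d -> V) c :
  ksubspace U -> (forall t, U (b t)) -> U (lincomb b c).
Proof.
move=> [U0 UD] Ub; rewrite /lincomb.
by elim/big_rec: _ => // t x _ Ux; apply: UD.
Qed.

Lemma has_dimP V (U : set V) d : has_dim U d <->
  exists b : 'I_d -> V, [/\ forall t, U (b t),
    forall c, lincomb b c = 0 -> c = 0 & forall x, U x -> exists c, x = lincomb b c].
Proof.
split=> -[b [Ub free span]]; exists b; split=> //.
- move=> c /free c0; apply/rowP => t; by rewrite mxE c0.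
- move=> x /span[c ->]; exists (\row_t c t).
  by apply: eq_bigr => t _; rewrite mxE.
- move=> c c0 t; have := free (\row_t c t); move/(_ _)/rowP/(_ t); rewrite !mxE.
  by apply; rewrite -[RHS]c0; apply: eq_bigr => s _; rewrite mxE.
- by move=> x /span[c ->]; exists (fun t => c 0 t).
Qed.

Lemma has_dim_le V (U W : set V) d e : (forall x, U x -> W x) ->
  has_dim U d -> has_dim W e -> (d <= e)%N.
Proof.
move=> UW /has_dimP[b [Ub free _]] /has_dimP[b' [_ _ span]].
have [A AE] := choice (fun t => span _ (UW _ (Ub t))).
pose M := \matrix_(t, s) A t 0 s.
have rM t : row t M = A t by apply/rowP => s; rewrite !mxE.
suff : row_free M by move=> /eqP <-; exact: rank_leq_col.
rewrite -kermx_eq0; apply/rowV0P => c /sub_kermxP cM; apply: free.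
rewrite (eq_lincomb _ (b' := fun t => lincomb b' (row t M))); last first.
  by move=> t; rewrite rM -AE.
by rewrite -lincombM cM lincomb0.
Qed.

Lemma has_dim_uniq V (U : set V) d e : has_dim U d -> has_dim U e -> d = e.
Proof.
by move=> hd he; apply/eqP; rewrite eqn_leq !(has_dim_le (fun=> id) _ (W := U)).
Qed.

Lemma has_dim_ext V (U W : set V) d : (forall x, U x <-> W x) ->
  has_dim U d -> has_dim W d.
Proof.
move=> UW [b [Ub free span]]; exists b; split=> // [t|x /UW /span //].
exact/UW.
Qed.

Lemma has_dim_finType V (U : set V) (I : finType) (b : I -> V) :
  (forall t, U (b t)) ->
  (forall c : I -> K, \sum_t (c t)%:MP_[n] *: b t = 0 -> forall t, c t = 0) ->
  (forall x, U x -> exists c : I -> K, x = \sum_t (c t)%:MP_[n] *: b t) ->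
  has_dim U #|I|.
Proof.
move=> Ub free span; exists (b \o @enum_val I I); split=> [t|c c0 t|x /span[c ->]].
- exact: Ub.
- have := free (c \o enum_rank).
  rewrite (reindex _ (onW_bij _ (@enum_val_bij I))) /=.
  have -> : \sum_(j < #|I|) (c (enum_rank (@enum_val I I j)))%:MP_[n]
      *: b (enum_val j) = 0.
    by rewrite -[RHS]c0; apply: eq_bigr => j _; rewrite enum_valK.
  by move=> /(_ erefl (enum_val t)); rewrite enum_valK.
- exists (c \o enum_val).
  exact: (reindex _ (onW_bij _ (@enum_val_bij I))).
Qed.

(** The rank-nullity theorem. In the coordinates given by a basis of U the kernel
    is the row space of some B; a basis of the complement B^C is mapped by f to a
    basis of the image. *)
Lemma has_dim_linear V W (f : {linear V -> W}) (U : set V) a :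
  ksubspace U -> has_dim U a ->
  exists k l, [/\ (k + l)%N = a, has_dim [set x | U x /\ f x = 0] k
    & has_dim [set y | exists2 x, U x & y = f x] l].
Proof.
move=> sU /has_dimP[b [Ub free span]].
have [||B BE] := @row_subspace K a [set c | f (lincomb b c) = 0].
- by rewrite /= lincomb0 linear0.
- by move=> c u v /= u0 v0; rewrite lincombZD linearP u0 v0 scaler0 addr0.
have Ulc c : U (lincomb b c) by exact: ksubspace_lincomb.
exists (\rank B), (\rank B^C%MS); split.
- by rewrite mxrank_compl subnKC // rank_leq_row.
- apply/has_dimP; exists (fun t => lincomb b (row t (row_base B))); split.
  + move=> t; split; first exact: Ulc.
    by apply/BE; rewrite (submx_trans (row_sub _ _)) ?eq_row_base.
  + move=> c; rewrite -lincombM => /free c0.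
    have := row_base_free B; rewrite -kermx_eq0 => /rowV0P; apply.
    exact/sub_kermxP.
  + move=> x [/span[c ->]] /BE; rewrite -(eq_row_base B) => /submxP[w ->].
    by exists w; rewrite -lincombM.
- apply/has_dimP.
  exists (fun t => f (lincomb b (row t (row_base B^C%MS)))); split.
  + by move=> t; exists (lincomb b (row t (row_base B^C%MS))).
  + move=> c; rewrite -(lincomb_linear f (fun t => lincomb b (row t _))) -lincombM.
    move=> /BE cB; have : (c *m row_base B^C <= B :&: B^C)%MS.
      by rewrite sub_capmx cB (submx_trans (submxMl _ _)) ?eq_row_base.
    rewrite capmx_compl submx0 => /eqP c0.
    have := row_base_free B^C%MS; rewrite -kermx_eq0 => /rowV0P; apply.
    exact/sub_kermxP.
  + move=> _ [_ /span[c ->] ->].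
    have : (c <= B + row_base B^C)%MS.
      rewrite (submx_trans (submx_full c (addsmx_compl_full B))) //.
      by rewrite addsmxS // eq_row_base.
    move=> /sub_addsmxP[[u v] /= ->]; exists v.
    rewrite -(lincomb_linear f (fun t => lincomb b (row t _))) -lincombM.
    rewrite -[u *m B]scale1r lincombZD linearP.
    suff -> : f (lincomb b (u *m B)) = 0 by rewrite scaler0 add0r.
    by apply/BE; exact: submxMl.
Qed.

End Dimension.

(** * Two minimal free resolutions have the same ranks *)
Section MinimalResolutionUnique.
Variables (K : fieldType) (n : nat) (M : gradedModule {mpoly K[n]}).
Local Notation S := {mpoly K[n]}.
Implicit Types F G : gradedFreeResolution M.

Lemma lift_rows (a b c e : nat) (X : 'M[S]_(a, b)) (B : 'M[S]_(b, c))
    (C : 'M[S]_(e, b)) :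
  (forall v : 'rV_b, v *m B = 0 <-> exists w, v = w *m C) ->
  X *m B = 0 -> exists Y, X = Y *m C.
Proof.
move=> ex XB0.
have h t : exists w, row t X = w *m C by apply/ex; rewrite -row_mul XB0 row0.
have [Y YE] := choice h; exists (\matrix_(t, s) Y t 0 s).
apply/row_matrixP => t; rewrite YE row_mul; congr (_ *m _).
by apply/rowP => s; rewrite !mxE.
Qed.

Lemma fdiff_comp F k : fdiff F k.+1 *m fdiff F k = 0.
Proof.
apply/row_matrixP => t; rewrite row_mul row0; apply/fdiff_exact.
by exists (delta_mx 0 t); rewrite rowE.
Qed.

(** The comparison map between two resolutions of M that lifts the identity,
    chosen one degree at a time; [comparison0] and [comparisonS] say that the
    choice is always possible. *)
Fixpoint comparison F G k : 'M[S]_(frank F k, frank G k) :=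
  if k is k'.+1 then
    xget 0 [set X | fdiff F k' *m comparison F G k' = X *m fdiff G k']
  else xget 0 [set X | forall v, faug G (v *m X) = faug F v].

Lemma comparison0 F G v : faug G (v *m comparison F G 0) = faug F v.
Proof.
apply: (@xgetPex _ 0 [set X | forall v, faug G (v *m X) = faug F v]).
have h t : exists w, faug G w = faug F (delta_mx 0 t) by exact: faug_surj.
have [Y YE] := choice h; exists (\matrix_(t, s) Y t 0 s) => /= w.
rewrite [w in RHS]row_sum_delta mulmx_sum_row !linear_sum; apply: eq_bigr => t _.
rewrite !linearZ -YE /=; congr (_ *: faug G _).
by apply/rowP => s; rewrite !mxE.
Qed.

Lemma comparisonS F G k :
  fdiff F k *m comparison F G k = comparison F G k.+1 *m fdiff G k.
Proof.
apply: (@xgetPex _ 0 [set X | fdiff F k *m comparison F G k = X *m fdiff G k]).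
elim: k => [|k IH].
  have h t : exists w, row t (fdiff F 0 *m comparison F G 0) = w *m fdiff G 0.
    apply/faug_exact; rewrite row_mul comparison0; apply/faug_exact.
    by exists (delta_mx 0 t); rewrite rowE.
  have [Y YE] := choice h; exists (\matrix_(t, s) Y t 0 s).
  apply/row_matrixP => t; rewrite YE row_mul; congr (_ *m _).
  by apply/rowP => s; rewrite !mxE.
have [|Y YE] := lift_rows (@fdiff_exact _ _ _ G k)
    (X := fdiff F k.+1 *m comparison F G k.+1); last by exists Y.
have /= e : fdiff F k *m comparison F G k = comparison F G k.+1 *m fdiff G k.
  exact: (xgetPex 0 IH).
by rewrite -mulmxA -e mulmxA fdiff_comp mul0mx.
Qed.

Local Notation ev0 := (map_mx (mcoeff 0%MM)).

(** The composite F -> G -> F lifts the identity of M, hence is homotopic to the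
    identity of F. The homotopy enters through products with differentials, which
    have no constant term when F is minimal. So the composite is the identity
    modulo the variables, and this bounds the ranks of F by those of G. *)
Lemma minimal_comparison F G : minimal_resolution F -> forall k,
  ev0 (comparison F G k *m comparison G F k) = 1%:M :> 'M[K]_(frank F k).
Proof.
move=> mF k; pose th k := comparison F G k *m comparison G F k - 1%:M.
have thS k' : fdiff F k' *m th k' = th k'.+1 *m fdiff F k'.
  rewrite mulmxBr mulmxBl mulmx1 mul1mx mulmxA comparisonS -mulmxA comparisonS.
  by rewrite mulmxA.
have d0 k' : ev0 (fdiff F k') = 0 by apply/matrixP => s t; rewrite !mxE mF.
(* The first condition carries the homotopy s from one degree to the next. *)
have : exists2 s, fdiff F k *m th k = fdiff F k *m s *m fdiff F k & ev0 (th k) = 0.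
  elim: k => [|k [s sE _]].
    have h t : exists w, row t (th 0%N) = w *m fdiff F 0.
      apply/faug_exact; rewrite rowE mulmxBr mulmx1 linearB /= mulmxA.
      by rewrite !comparison0 subrr.
    have [Y YE] := choice h.
    have e : th 0%N = (\matrix_(t, s) Y t 0 s) *m fdiff F 0.
      apply/row_matrixP => t; rewrite YE row_mul; congr (_ *m _).
      by apply/rowP => s; rewrite !mxE.
    exists (\matrix_(t, s) Y t 0 s); first by rewrite e mulmxA.
    by rewrite e map_mxM d0 mulmx0.
  have [|Y YE] := lift_rows (@fdiff_exact _ _ _ F k)
    (X := th k.+1 - fdiff F k *m s).
    by rewrite mulmxBl -thS sE subrr.
  have e : th k.+1 = Y *m fdiff F k.+1 + fdiff F k *m s by rewrite -YE subrK.
  exists Y.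
    by rewrite {1}e mulmxDr (mulmxA _ (fdiff F k)) fdiff_comp mul0mx addr0 mulmxA.
  by rewrite e map_mxD !map_mxM !d0 mulmx0 mul0mx addr0.
move=> [_ _ /eqP]; rewrite /th map_mxB subr_eq0 => /eqP ->.
by rewrite map_mx1.
Qed.

Lemma minimal_frank_le F G k :
  minimal_resolution F -> (frank F k <= frank G k)%N.
Proof.
by move=> mF; have := minimal_comparison G mF k; rewrite map_mxM => /mulmx1_min.
Qed.

Lemma betti_minimal F k : minimal_resolution F -> betti M k = frank F k.
Proof.
move=> mF; rewrite /betti; case: xgetP => [b _ [G mG ->]|]; last first.
  by move=> /(_ (frank F k)) []; exists F.
by apply/eqP; rewrite eqn_leq !minimal_frank_le.
Qed.

End MinimalResolutionUnique.

(** * The Koszul complex *)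
Section Homogeneous.
Variables (K : fieldType) (n : nat).
Local Notation S := {mpoly K[n]}.

Lemma dhomog_mcoeff e (p : S) :
  (p \is e.-homog) <-> (forall m, mdeg m != e -> p@_m = 0).
Proof.
split=> [h m|h]; first exact: dhomog_nemf_coeff.
apply/dhomogP => m; rewrite mcoeff_msupp => pm.
by apply/eqP; apply: contraNT pm => /h ->.
Qed.

Lemma mderiv_homog e i (p : S) : p \is e.-homog -> p^`M(i) \is e.-1.-homog.
Proof.
move=> /dhomog_mcoeff h; apply/dhomog_mcoeff => m me.
rewrite mcoeff_deriv h ?mul0rn // mdegD mdeg1 addn1.
by apply: contraNneq me => <-.
Qed.

Lemma mulXi_homog e i (p : S) : p \is e.-homog -> 'X_i * p \is e.+1.-homog.
Proof. by move=> h; rewrite -add1n; apply: dhomogM => //; rewrite dhomogX /= mdeg1. Qed.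

Lemma euler_homog e (p : S) : p \is e.-homog ->
  \sum_i 'X_i * p^`M(i) = e%:R *: p.
Proof.
move=> /dhomogP h; rewrite [in RHS](mpolyE p) scaler_sumr.
under eq_bigr => i _.
  rewrite [in p^`M(i)](mpolyE p) linear_sum mulr_sumr.
  under eq_bigr => m _ do rewrite /= mderivZ mderivX.
  over.
rewrite exchange_big; apply: eq_big_seq => m /h <- /=.
rewrite mdegE natr_sum scaler_suml; apply: eq_bigr => i _.
rewrite -!scalerAr !scalerA mulrC; case: (posnP (m i)) => [->|mi].
  by rewrite mul0r !scale0r.
by rewrite -mpolyXD addmC submK // lep1mP -lt0n.
Qed.

End Homogeneous.

Section Koszul.
Variables (K : fieldType) (n : nat).
Hypothesis charK : [pchar K] =i pred0.
Local Notation S := {mpoly K[n]}.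
Implicit Types (A : {set 'I_n}) (u : {set 'I_n} -> S).

Lemma natK_neq0 k : (k != 0)%N -> k%:R != 0 :> K.
Proof. by move=> k0; rewrite (proj1 (pcharf0P K) charK). Qed.

Definition ksign A (i : 'I_n) : S := (-1) ^+ #|[set j in A | (j < i)%N]|.

Lemma ksign_sqr A i : ksign A i * ksign A i = 1.
Proof. by rewrite /ksign -exprMn mulrNN mulr1 expr1n. Qed.

Lemma ksignU1 A i j : j \notin A ->
  ksign (j |: A) i = (if (j < i)%N then -1 else 1) * ksign A i.
Proof.
move=> jA; rewrite /ksign; case: ifP => ji.
  rewrite -exprS (_ : [set k in _ | _] = j |: [set k in A | (k < i)%N]).
    by rewrite cardsU1 !inE (negPf jA).
  by apply/finset.setP => k; rewrite !inE; case: eqP => [->|].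
rewrite mul1r; congr (_ ^+ _); apply: eq_card => k.
by rewrite !inE; case: eqP => [->|//]; rewrite ji !andbF.
Qed.

Lemma ksignD1 A i : ksign (A :\ i) i = ksign A i.
Proof.
rewrite /ksign; congr (_ ^+ _); apply: eq_card => k.
by rewrite !inE; case: eqP => [->|//]; rewrite ltnn !andbF.
Qed.

(** Families indexed by the subsets of 'I_n stand for elements of the exterior
    algebra over S; the degree p part is carried by the subsets of size p. *)
Definition koszul u A : S :=
  \sum_(i | i \notin A) 'X_i * (ksign A i * u (i |: A)).

(** The exterior derivative, read on the same families. *)
Definition koszul_homotopy u A : S :=
  \sum_(i in A) ksign A i * (u (A :\ i))^`M(i).

Lemma mderiv_ksign A i j (p : S) : (ksign A i * p)^`M(j) = ksign A i * p^`M(j).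
Proof.
rewrite /ksign -signr_odd; case: (odd _); last by rewrite !mul1r.
by rewrite expr1 !mulN1r mderivN.
Qed.

Lemma mderivXM i j (p : S) :
  ('X_i * p)^`M(j) = (i == j)%:R *: p + 'X_i * p^`M(j).
Proof.
rewrite mderivM mderivX mnm1E; case: eqP => [->|_]; last by rewrite !scale0r mul0r.
by rewrite (_ : U_(j) - U_(j) = 0)%MM ?mpolyX0 -?scalerAl ?mul1r //; apply/mnmP => k;
  rewrite mnmBE subnn mnm0E.
Qed.

Lemma ksign_swap A i j : i \notin A -> j \in A ->
  ksign A i * ksign (i |: A) j = - (ksign A j * ksign (A :\ j) i).
Proof.
move=> iA jA; rewrite (ksignU1 _ iA) -{1}(finset.setD1K jA) ksignU1 ?finset.setD11 //.
have nij : nat_of_ord i != j by apply: contraNneq iA => /val_inj ->.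
by case: (ltngtP i j) nij => // _ _; ring.
Qed.

(** Cartan's formula for the Euler vector field: the terms that exchange an element
    of A with one outside A cancel in pairs by [ksign_swap]; the others add up to
    the Euler operator, by the Leibniz rule. *)
Lemma koszul_cartan u A e : (forall B, u B \is e.-homog) ->
  koszul (koszul_homotopy u) A + koszul_homotopy (koszul u) A =
  (e + #|A|)%:R *: u A.
Proof.
move=> hu.
have E1 : koszul (koszul_homotopy u) A = \sum_(i | i \notin A) 'X_i * (u A)^`M(i)
  + \sum_(i | i \notin A) \sum_(j in A)
      'X_i * (ksign A i * ksign (i |: A) j * (u ((i |: A) :\ j))^`M(j)).
  rewrite -big_split; apply: eq_bigr => i iA /=.
  rewrite /koszul_homotopy big_setU1 //= finset.setU1K // !mulrDr; congr (_ + _).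
    by rewrite ksignU1 // ltnn mul1r [ksign A i * _]mulrA ksign_sqr mul1r.
  by rewrite !mulr_sumr; apply: eq_bigr => j _; rewrite !mulrA.
have E2 : koszul_homotopy (koszul u) A =
  \sum_(j in A) (u A + 'X_j * (u A)^`M(j)) + \sum_(j in A) \sum_(i | i \notin A)
      'X_i * (ksign A j * ksign (A :\ j) i * (u (i |: (A :\ j)))^`M(j)).
  rewrite -big_split; apply: eq_bigr => j jA /=.
  rewrite /koszul (bigD1 j) ?finset.setD11 //= mderivD mulrDr; congr (_ + _).
    rewrite mderivXM eqxx scale1r mderiv_ksign finset.setD1K // ksignD1.
    rewrite mulrDr mulrA ksign_sqr mul1r; congr (_ + _).
    by rewrite mulrCA [ksign A j * (_ * _)]mulrA ksign_sqr mul1r.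
  rewrite linear_sum mulr_sumr; apply: eq_big => [i|i /andP[_ ij]].
    by rewrite !inE; case: eqP => [->|]; rewrite ?jA ?andbF ?andbT.
  by rewrite /= mderivXM (negPf ij) scale0r add0r mderiv_ksign; ring.
rewrite E1 E2 addrACA [X in _ + X](_ : _ = 0) ?addr0.
  rewrite big_split /= sumr_const natrD scalerDl -(euler_homog (hu A)).
  rewrite [X in _ = X + _](bigID (mem A)) /= scaler_nat addrCA [RHS]addrC.
  by congr (_ + _); rewrite addrC.
rewrite [X in _ + X]exchange_big -big_split /= big1 // => i iA.
rewrite -big_split big1 //= => j jA.
rewrite ksign_swap // (_ : (i |: A) :\ j = i |: (A :\ j)); first ring.
apply/finset.setP => k; rewrite !inE; case: (eqVneq k i) => [->|//].
by rewrite (_ : i != j) //; apply: contraNneq iA => ->.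
Qed.

(** Characteristic 0 allows division by 2. *)
Lemma sum_antisym (F : 'I_n -> 'I_n -> S) :
  (forall i j, F i j = - F j i) -> \sum_i \sum_j F i j = 0.
Proof.
move=> aF; set s := \sum_i _.
have e : s = - s.
  rewrite -sumrN [LHS]exchange_big; apply: eq_bigr => j _ /=.
  by rewrite -sumrN; apply: eq_bigr.
have : 2%:R *: s = 0.
  by rewrite scaler_nat mulr2n {2}e subrr.
by move=> /eqP; rewrite mscalerI (negPf (natK_neq0 _)) // => /eqP.
Qed.

Lemma koszulK u A : koszul (koszul u) A = 0.
Proof.
pose F i j := if (i \notin A) && (j \notin i |: A) then
  'X_i * (ksign A i * ('X_j * (ksign (i |: A) j * u (j |: (i |: A))))) else 0.
transitivity (\sum_i \sum_j F i j).
  rewrite /koszul big_mkcond; apply: eq_bigr => i _.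
  case: ifP => iA; last by rewrite big1 // => j _; rewrite /F iA.
  rewrite !mulr_sumr big_mkcond; apply: eq_bigr => j _.
  by rewrite /F iA /=; case: ifP.
apply: sum_antisym => i j; rewrite /F !inE (eq_sym j i).
case: (eqVneq i j) => /= [->|nij]; first by rewrite andbF oppr0.
case: (boolP (i \in A)) => iA; first by rewrite andbF oppr0.
case: (boolP (j \in A)) => jA /=; first by rewrite oppr0.
rewrite (ksignU1 _ iA) (ksignU1 _ jA) (finset.setUCA [set j]).
have : nat_of_ord i != j by apply: contraNneq nij => /val_inj ->.
by case: (ltngtP i j) => // _ _; ring.
Qed.

Section Rows.
Variable m : nat.
Implicit Types w : {set 'I_n} -> 'rV[S]_m.

Definition vhomog m e (v : 'rV[S]_m) := forall t, v 0 t \is e.-homog.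

Definition kchain p e w :=
  forall A, (#|A| != p -> w A = 0) /\ vhomog e (w A).

(** The Koszul differential of a free module, written on vectors so that it
    commutes with right multiplication by a matrix. *)
Definition vkoszul m (w : {set 'I_n} -> 'rV[S]_m) A : 'rV[S]_m :=
  \sum_(i | i \notin A) ('X_i * ksign A i) *: w (i |: A).

Lemma vkoszulE w A t : vkoszul w A 0 t = koszul (fun B => w B 0 t) A.
Proof. by rewrite summxE; apply: eq_bigr => i _; rewrite mxE mulrA. Qed.

Lemma vkoszulK w A : vkoszul (vkoszul w) A = 0.
Proof.
apply/rowP => t; rewrite vkoszulE mxE -[RHS](koszulK (fun B => w B 0 t) A).
by apply: eq_bigr => i _; rewrite vkoszulE.
Qed.

Lemma vkoszulB w w' A :
  vkoszul (fun B => w B - w' B) A = vkoszul w A - vkoszul w' A.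
Proof. by rewrite -sumrB; apply: eq_bigr => i _; rewrite scalerBr. Qed.

Lemma vkoszul_mul m' (G : 'M[S]_(m, m')) w A :
  vkoszul (fun B => w B *m G) A = vkoszul w A *m G.
Proof. by rewrite mulmx_suml; apply: eq_bigr => i _; rewrite -scalemxAl. Qed.

Lemma ksign_homog A i : ksign A i \is 0.-homog.
Proof.
by rewrite /ksign -signr_odd; case: (odd _); rewrite ?rpredN ?dhomog1.
Qed.

Lemma vkoszul_chain p e w : kchain p.+1 e w -> kchain p e.+1 (vkoszul w).
Proof.
move=> hw A; split=> [Ap|t].
  rewrite /vkoszul big1 // => i iA; rewrite (proj1 (hw _)) ?scaler0 //.
  by rewrite cardsU1 iA.
rewrite summxE rpred_sum // => i iA; rewrite mxE.
rewrite -[e.+1]add0n -mulrA mulrCA; apply: dhomogM; first exact: ksign_homog.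
by apply: mulXi_homog; apply: (proj2 (hw _)).
Qed.

(** By Cartan's formula, dividing the exterior derivative of a cycle by its total
    degree gives a chain that it bounds; in characteristic 0 the only obstruction
    is the total degree 0, that is, the constants. *)
Lemma vkoszul_exact p e w : kchain p e w -> (forall A, vkoszul w A = 0) ->
  (0 < p + e)%N ->
  exists2 w', kchain p.+1 e.-1 w' & forall A, vkoszul w' A = w A.
Proof.
move=> hw w0 pe.
pose c : K := (e + p)%:R^-1.
pose w' A := \row_t (c *: koszul_homotopy (fun B => w B 0 t) A).
exists w' => A.
  split=> [Ap|t].
    apply/rowP => t; rewrite !mxE /koszul_homotopy big1 ?scaler0 // => i iA.
    rewrite (proj1 (hw _)) ?mxE ?mderiv0 ?mulr0 //.
    by apply: contraNneq Ap => <-; rewrite (cardsD1 i A) iA.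
  rewrite mxE rpredZ // rpred_sum // => i iA; rewrite -[e.-1]add0n.
  by apply: dhomogM; [exact: ksign_homog | apply: mderiv_homog; apply: (proj2 (hw _))].
apply/rowP => t.
have [Ap|Ap] := eqVneq #|A| p; last first.
  rewrite (proj1 (hw A)) // mxE vkoszulE /koszul big1 // => i iA.
  rewrite mxE /koszul_homotopy big1 ?scaler0 ?mulr0 // => j jA.
  rewrite (proj1 (hw _)) ?mxE ?mderiv0 ?mulr0 //; apply: contraNneq Ap => <-.
  by have := cardsD1 j (i |: A); rewrite jA cardsU1 iA => /eqP; rewrite eqSS => /eqP->.
have := @koszul_cartan (fun B => w B 0 t) A e (fun B => proj2 (hw B) t).
rewrite [koszul_homotopy (koszul _) A]big1 ?addr0; last first.
  by move=> i iA; rewrite -vkoszulE w0 mxE mderiv0 mulr0.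
move=> E; have -> : vkoszul w' A 0 t = c *: koszul (koszul_homotopy (fun B => w B 0 t)) A.
  rewrite vkoszulE scaler_sumr; apply: eq_bigr => i iA.
  by rewrite mxE -!scalerAr.
by rewrite E Ap scalerA mulVf ?scale1r // natK_neq0 // addnC -lt0n.
Qed.

End Rows.
End Koszul.

(** * Homogeneous vectors and their dimensions *)
Section HomogeneousParts.
Variables (K : fieldType) (n : nat).
Local Notation S := {mpoly K[n]}.

Lemma pihomog_mulr e d (p q : S) : q \is d.-homog ->
  pihomog mdeg (e + d) (p * q) = pihomog mdeg e p * q.
Proof.
move=> hq; rewrite {1}(pihomog_partitionE (p := p) (leq_addr e (msize p))).
rewrite mulr_suml linear_sum /=.
have part k : pihomog mdeg (e + d) (pihomog mdeg k p * q) =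
    if k == e then pihomog mdeg e p * q else 0.
  have h : pihomog mdeg k p * q \is (k + d).-homog by rewrite dhomogM ?pihomogP.
  case: eqP => [<-|/eqP ne]; first by rewrite pihomog_dE.
  by apply: pihomog_ne0 h; rewrite eqn_add2r.
under eq_bigr do rewrite part.
rewrite -big_mkcond /=; have [le|lt] := ltnP e (msize p + e).
  by rewrite (big_pred1 (Ordinal le)).
move: lt; rewrite -[leqRHS]add0n leq_add2r leqn0 msize_poly_eq0 => /eqP->.
by rewrite big1 // linear0 mul0r.
Qed.

Lemma pihomog_mulr_lt e d (p q : S) : q \is d.-homog -> (e < d)%N ->
  pihomog mdeg e (p * q) = 0.
Proof.
move=> hq ed; rewrite (pihomog_partitionE (p := p) (leqnn (msize p))).
rewrite mulr_suml linear_sum /= big1 // => k _.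
have h : pihomog mdeg k p * q \is (k + d).-homog by rewrite dhomogM ?pihomogP.
by apply: pihomog_ne0 h; rewrite gtn_eqF // (leq_trans ed) ?leq_addl.
Qed.

Section Rows.
Variable m : nat.
Implicit Types v w : 'rV[S]_m.

Definition vpart m e (v : 'rV[S]_m) : 'rV[S]_m := map_mx (pihomog mdeg e) v.

Lemma vpart_homog e v : vhomog e (vpart e v).
Proof. by move=> t; rewrite mxE pihomogP. Qed.

Lemma vpart_id e v : vhomog e v -> vpart e v = v.
Proof. by move=> hv; apply/rowP => t; rewrite mxE pihomog_dE. Qed.

Lemma vpart_sum v N : (forall t, (msize (v 0%R t) <= N)%N) ->
  v = \sum_(e < N) vpart e v.
Proof.
move=> vN; apply/rowP => t; rewrite summxE [LHS](pihomog_partitionE (vN t)).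
by apply: eq_bigr => e _; rewrite mxE.
Qed.

Lemma vpart_bound v : exists N, forall t, (msize (v 0%R t) <= N)%N.
Proof.
exists (\max_t msize (v 0%R t)) => t.
exact: (@leq_bigmax _ (fun t => msize (v 0%R t)) t).
Qed.

Lemma vhomog0 e : vhomog e (0 : 'rV[S]_m).
Proof. by move=> t; rewrite mxE rpred0. Qed.

Lemma vhomogD e v w : vhomog e v -> vhomog e w -> vhomog e (v + w).
Proof. by move=> hv hw t; rewrite mxE rpredD. Qed.

Lemma vhomogN e v : vhomog e v -> vhomog e (- v).
Proof. by move=> hv t; rewrite mxE rpredN. Qed.

Lemma vhomogZ e d (p : S) v : p \is d.-homog -> vhomog e v -> vhomog (d + e) (p *: v).
Proof. by move=> hp hv t; rewrite mxE dhomogM. Qed.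

Lemma ksub_vhomog e : ksubspace (vhomog (n := n) (K := K) (m := m) e).
Proof.
split; first exact: vhomog0.
move=> c u v hu hv; apply: vhomogD => //; rewrite -[e]add0n.
by apply: vhomogZ => //; rewrite -[c%:MP]mulr1 mul_mpolyC rpredZ // dhomog1.
Qed.

End Rows.

Definition mxhomog d a b (G : 'M[S]_(a, b)) := forall s t, G s t \is d.-homog.

Section Mul.
Variables (d a b : nat) (G : 'M[S]_(a, b)).
Hypothesis hG : mxhomog d G.

Lemma vhomog_mul e v : vhomog e v -> vhomog (e + d) (v *m G).
Proof. by move=> hv t; rewrite mxE rpred_sum // => s _; rewrite dhomogM. Qed.

Lemma vpart_mul e v : vpart (e + d) (v *m G) = vpart e v *m G.
Proof.
apply/rowP => t; rewrite !mxE linear_sum; apply: eq_bigr => s _ /=.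
by rewrite mxE pihomog_mulr.
Qed.

Lemma vpart_mul_lt e v : (e < d)%N -> vpart e (v *m G) = 0.
Proof.
move=> ed; apply/rowP => t; rewrite !mxE linear_sum big1 // => s _ /=.
by rewrite (pihomog_mulr_lt _ (hG s t)).
Qed.

Lemma vhomog_factor e v w : vhomog (e + d) v -> v = w *m G ->
  exists2 w', vhomog e w' & v = w' *m G.
Proof.
move=> hv vw; exists (vpart e w); first exact: vpart_homog.
by rewrite -vpart_mul -vw vpart_id.
Qed.

Lemma vpart_ker e v : v *m G = 0 -> vpart e v *m G = 0.
Proof.
move=> v0; rewrite -vpart_mul v0; apply/rowP => t.
by rewrite !mxE linear0.
Qed.

End Mul.
End HomogeneousParts.

Section Monomials.
Variable n : nat.
Hypothesis n_gt0 : (0 < n)%N.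

(** The number of monomials of degree e in n variables, when n is positive. *)
Definition nmon e := 'C(e + n.-1, e).

Definition monos e : seq 'X_{1..n} := [seq s2m t | t : e.-tuple 'I_n <- enum (mpoly.basis n e)].

Definition mono e (s : 'I_(nmon e)) : 'X_{1..n} := nth 0%MM (monos e) s.

Lemma size_monos e : size (monos e) = nmon e.
Proof. by move: n_gt0; rewrite /monos /nmon; case: n => // n' _; exact: size_basis. Qed.

Lemma mem_monos e m : (m \in monos e) = (mdeg m == e).
Proof. by rewrite basis_cover. Qed.

Lemma mdeg_mono e (s : 'I_(nmon e)) : mdeg (mono s) = e.
Proof. by apply/eqP; rewrite -mem_monos mem_nth // size_monos. Qed.

Lemma mono_inj e : injective (@mono e).
Proof.
move=> s t /eqP; rewrite nth_uniq ?size_monos ?uniq_basis // => /eqP.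
exact: val_inj.
Qed.

Lemma monoP e m : mdeg m = e -> exists s : 'I_(nmon e), m = mono s.
Proof.
move=> me; have mi : m \in monos e by rewrite mem_monos me.
have im : (index m (monos e) < nmon e)%N by rewrite -size_monos index_mem.
by exists (Ordinal im); rewrite /mono nth_index.
Qed.

End Monomials.

Section VhomogDim.
Variables (K : fieldType) (n : nat).
Hypothesis n_gt0 : (0 < n)%N.
Local Notation S := {mpoly K[n]}.

Lemma has_dim_monomials m (I : finType) (h : I -> 'X_{1..n}) : injective h ->
  has_dim [set v : 'rV[S]_m | forall t k, (forall i, h i != k) -> (v 0 t)@_k = 0]
    (m * #|I|).
Proof.
move=> injh; pose b (i : 'I_m * I) : 'rV[S]_m := 'X_[h i.2] *: delta_mx 0 i.1.
have bE c t k : ((\sum_i (c i)%:MP_[n] *: b i) 0 t)@_k =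
    \sum_i c i * (h i.2 == k)%:R * (i.1 == t)%:R.
  rewrite summxE raddf_sum; apply: eq_bigr => -[s k'] _ /=.
  rewrite !mxE /= mul_mpolyC mcoeffZ -mulrA; congr (_ * _).
  by case: eqVneq => _; rewrite ?mulr1 ?mulr0 ?mcoeffX ?mcoeff0.
have single (c : 'I_m * I -> K) t s :
    \sum_i c i * (h i.2 == h s)%:R * (i.1 == t)%:R = c (t, s).
  rewrite (bigD1 (t, s)) //= !eqxx !mulr1 big1 ?addr0 // => -[t' s'] /=.
  rewrite xpair_eqE negb_and => /orP[ne|ne]; first by rewrite (negPf ne) mulr0.
  by rewrite (inj_eq injh) (negPf ne) mulr0 mul0r.
rewrite -[m in (m * _)%N]card_ord -card_prod; apply: (has_dim_finType (b := b)).
- move=> i t k hk; rewrite !mxE; case: (_ && _); rewrite ?mulr0 ?mcoeff0 // mulr1.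
  by rewrite mcoeffX (negPf (hk _)).
- by move=> c c0 [t s]; rewrite -(single c) -bE c0 mxE mcoeff0.
- move=> v hv; exists (fun i => (v 0 i.1)@_(h i.2)).
  apply/rowP => t; apply/mpolyP => k; rewrite bE.
  have [/existsP[s /eqP <-]|nk] := boolP [exists s, h s == k].
    by rewrite (single (fun i => (v 0 i.1)@_(h i.2))).
  have nk' s : h s != k by apply: contra nk => sk; apply/existsP; exists s.
  rewrite hv // big1 // => -[t' s] _ /=.
  by rewrite (negPf (nk' s)) mulr0 mul0r.
Qed.

Lemma has_dim_vhomog m e :
  has_dim (vhomog (n := n) (K := K) (m := m) e) (m * nmon n e).
Proof.
rewrite -[nmon n e]card_ord.
apply: has_dim_ext (has_dim_monomials m (@mono_inj n n_gt0 e)) => v /=.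
split=> [h t|hv t k hk].
  apply/dhomog_mcoeff => k ke; apply: h => s.
  by apply: contraNneq ke => <-; rewrite mdeg_mono.
apply: (dhomog_nemf_coeff (hv t)); apply/negP => /eqP /(monoP n_gt0)[s ks].
by have := hk s; rewrite ks eqxx.
Qed.

Lemma card_bmultinom D : #|{: 'X_{1..n < D}}| = 'C(D + n.-1, n).
Proof.
transitivity (\sum_(e < D) nmon n e)%N.
  rewrite -sum1_card (partition_big (fun m : 'X_{1..n < D} => Ordinal (bmdeg m)) predT) //=.
  apply: eq_bigr => e _; rewrite sum1_card -[RHS]card_ord.
  have lt (s : 'I_(nmon n e)) : (mdeg (mono s) < D)%N by rewrite mdeg_mono.
  have inj : injective (fun s : 'I_(nmon n e) => BMultinom (lt s)).
    by move=> s t /(congr1 val) /= /(mono_inj n_gt0).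
  rewrite -(card_codom inj); apply: eq_card => m; rewrite unfold_in.
  apply/eqnP/codomP => [/= /(monoP n_gt0)[s ms]|[s ->]].
    by exists s; apply: val_inj.
  by rewrite /= mdeg_mono.
move: n_gt0; case: n => // n' _; rewrite /nmon /=.
elim: D => [|D IH]; first by rewrite big_ord0 bin_small.
rewrite big_ord_recr /= IH addSn binS; congr (_ + _)%N.
by rewrite -[RHS]bin_sub ?leq_addl // addnK.
Qed.

Definition vbound m D : set 'rV[S]_m := [set v | forall t, (msize (v 0%R t) <= D)%N].

Lemma has_dim_vbound m D : has_dim (@vbound m D) (m * 'C(D + n.-1, n)).
Proof.
rewrite -card_bmultinom.
apply: has_dim_ext (has_dim_monomials m (h := @bmnm n D) val_inj) => v /=.
split=> h t; last first.
  move=> k hk; apply: memN_msupp_eq0; apply: msize_mdeg_ge; rewrite (leq_trans (h t)) //.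
  by rewrite leqNgt; apply/negP => kD; have := hk (BMultinom kD); rewrite eqxx.
rewrite msizeE; apply/bigmax_leqP_seq => k; rewrite mcoeff_msupp => vk _.
rewrite ltnNge; apply: contra vk => Dk; apply/eqP; apply: h => i.
by apply: contraTneq Dk => <-; rewrite -ltnNge bmdeg.
Qed.

Lemma ksub_vbound m D : ksubspace (@vbound m D).
Proof.
split=> [t|c u v hu hv t]; first by rewrite mxE mmeasure0.
rewrite !mxE (leq_trans (msizeD_le _ _)) // geq_max hv andbT mul_mpolyC.
exact: leq_trans (mmeasureZ_le _ _ _) (hu t).
Qed.

Lemma vhomog_vbound m D e (v : 'rV[S]_m) : vhomog e v -> (e < D)%N -> vbound D v.
Proof.
move=> hv eD t; rewrite msizeE; apply/bigmax_leqP_seq => k.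
by move=> /(dhomog_mf (hv t)) /= ->.
Qed.

Lemma vbound_sum m D (I : finType) (F : I -> 'rV[S]_m) :
  (forall i, vbound D (F i)) -> vbound D (\sum_i F i).
Proof.
move=> hF; elim/big_ind: _ => [|u v hu hv|//]; first exact: (proj1 (ksub_vbound m D)).
by rewrite -[u]scale1r -mpolyC1; apply: (proj2 (ksub_vbound m D)).
Qed.

Lemma has_dim_ker a b (G : 'M[S]_(a, b)) e :
  exists z, has_dim [set v | vhomog e v /\ v *m G = 0] z.
Proof.
have [k [l [_ hk _]]] := has_dim_linear (mulmxr G) (ksub_vhomog _ _ _ e)
  (has_dim_vhomog a e).
by exists k.
Qed.

(** A K-basis of the syzygies of G of degree e, stored as the rows of a matrix. It
    is an informative choice because it is iterated to build a resolution. *)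
Lemma syzygy_basis a b (G : 'M[S]_(a, b)) e :
  {x : {m : nat & 'M[S]_(m, a)} |
   [/\ has_dim [set v | vhomog e v /\ v *m G = 0] (tag x),
       mxhomog e (tagged x) /\ tagged x *m G = 0,
       forall c : 'rV[K]_(tag x), map_mx (@mpolyC n K) c *m tagged x = 0 -> c = 0 &
       forall v, vhomog e v -> v *m G = 0 ->
         exists c : 'rV[K]_(tag x), v = map_mx (@mpolyC n K) c *m tagged x]}.
Proof.
apply: cid; have [z hz] := has_dim_ker G e.
have /has_dimP[f [fU free span]] := hz.
pose X := \matrix_t f t.
have XE c : map_mx (@mpolyC n K) c *m X = lincomb f c.
  by rewrite mulmx_sum_row; apply: eq_bigr => t _; rewrite mxE rowK.
exists (Tagged (fun m => 'M[S]_(m, a)) X); split=> //=.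
- split; first by move=> s t; rewrite mxE; apply: (proj1 (fU s)).
  by apply/row_matrixP => s; rewrite row_mul rowK (proj2 (fU s)) row0.
- by move=> c; rewrite XE; exact: free.
- by move=> v hv v0; have [c ->] := span v (conj hv v0); exists c; rewrite XE.
Qed.

End VhomogDim.

(** * Linear resolutions from Koszul homology *)
Section Strand.
Variables (K : fieldType) (n : nat).
Hypothesis charK : [pchar K] =i pred0.
Local Notation S := {mpoly K[n]}.

(** Z starts in degree d, and its p-th Koszul homology is concentrated in degree
    d + p. For a graded submodule Z of a free module this is equivalent to having
    a linear resolution, and it is a condition that passes to the syzygies of Z. *)
Definition linear_strand m (Z : set 'rV[S]_m) d :=
  (forall e v, Z v -> vhomog e v -> (e < d)%N -> v = 0) /\
  (forall p e w, (d < e)%N -> kchain p e w -> (forall A, Z (w A)) ->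
     (forall A, vkoszul w A = 0) ->
     exists w', [/\ kchain p.+1 e.-1 w', forall A, Z (w' A)
                  & forall A, vkoszul w' A = w A]).

(** The preimages are chosen set by set, so they can be kept homogeneous and
    supported in the same exterior degree. *)
Lemma kchain_factor p e d a b (G : 'M[S]_(a, b)) w : mxhomog d G ->
  kchain p (e + d) w -> (forall A, exists v, w A = v *m G) ->
  exists2 w', kchain p e w' & forall A, w A = w' A *m G.
Proof.
move=> hG hw h.
have h' (A : {set 'I_n}) : exists v : 'rV[S]_a, (#|A| != p -> v = 0) /\ vhomog e v /\ w A = v *m G.
  have [Ap|Ap] := eqVneq #|A| p; last first.
    exists 0; split=> //; split; first exact: vhomog0.
    by rewrite mul0mx (proj1 (hw A)).
  have [v wv] := h A.
  by have [v' hv' wv'] := vhomog_factor hG (proj2 (hw A)) wv; exists v'.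
have [w' w'E] := choice h'; exists w' => A.
  by split; [exact: (proj1 (w'E A)) | exact: (proj1 (proj2 (w'E A)))].
exact: (proj2 (proj2 (w'E A))).
Qed.

Section Syzygies.
Variables (d a b m : nat) (G : 'M[S]_(a, b)) (H : 'M[S]_(m, a)).
Let Z : set 'rV[S]_a := [set v | v *m G = 0].
Hypothesis hG : exists g, mxhomog g G.
Hypothesis strandZ : linear_strand Z d.
Hypothesis hH : mxhomog d H.
Hypothesis HG0 : H *m G = 0.
Hypothesis freeH :
  forall c : 'rV[K]_m, map_mx (@mpolyC n K) c *m H = 0 -> c = 0.
Hypothesis spanH : forall v, vhomog d v -> v *m G = 0 ->
  exists c : 'rV[K]_m, v = map_mx (@mpolyC n K) c *m H.

(** An element v of degree larger than d is a Koszul 0-cycle, hence a combination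
    of the variables with coefficients in Z of smaller degree. *)
Lemma strand_generated e v : vhomog (e + d) v -> v *m G = 0 ->
  exists w, v = w *m H.
Proof.
elim: e v => [|e IH] v hv vG.
  by have [c ->] := spanH hv vG; exists (map_mx (@mpolyC n K) c).
pose w (A : {set 'I_n}) := if A == finset.set0 then v else 0.
have [||||w' [hw' w'Z w'E]] := proj2 strandZ 0%N (e.+1 + d)%N w.
- by rewrite addSn ltnS leq_addl.
- move=> A; rewrite /w -cards_eq0; case: eqP => //= _; split=> //.
  exact: vhomog0.
- by move=> A; rewrite /w /Z /=; case: eqP; rewrite ?mul0mx.
- move=> A; rewrite /vkoszul big1 // => i _; rewrite /w -cards_eq0 cardsU1.
  case: (boolP (i \in A)) => iA /=; last by rewrite scaler0.
  by rewrite add0n cards_eq0; case: eqP iA => [->|_ _]; rewrite ?inE // scaler0.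
have h i : exists u, w' (i |: finset.set0) = u *m H.
  by apply: IH; [exact: (proj2 (hw' _)) | exact: w'Z].
have [u uE] := choice h.
exists (\sum_i ('X_i * ksign _ finset.set0 i) *: u i).
have := w'E finset.set0; rewrite /w eqxx => <-.
rewrite mulmx_suml /vkoszul; apply: eq_big => [i|i _]; first by rewrite inE.
by rewrite uE scalemxAl.
Qed.

Lemma strand_exact (v : 'rV[S]_a) : v *m G = 0 <-> exists w, v = w *m H.
Proof.
split=> [v0|[w ->]]; last by rewrite -mulmxA HG0 mulmx0.
have [N vN] := vpart_bound v; have [g hg] := hG.
have h e : exists w, vpart e v = w *m H.
  have [ed|ed] := ltnP e d.
    exists 0; rewrite mul0mx; apply: (proj1 strandZ e) => //; last exact: vpart_homog.
    exact: (vpart_ker hg).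
  rewrite -(subnK ed); apply: strand_generated; first exact: vpart_homog.
  exact: (vpart_ker hg).
have [w wE] := choice h; exists (\sum_(e < N) w e).
by rewrite (vpart_sum vN) mulmx_suml; apply: eq_bigr => e _.
Qed.

(** The long exact sequence of Koszul homology, for 0 -> ker H -> S^m -> Z -> 0: a
    cycle w of ker H bounds some u in the free module; u *m H is a cycle of Z of
    degree larger than d, so it bounds some t, and correcting u by the boundary of
    a lift of t moves it into ker H. *)
Lemma strand_step : linear_strand [set v | v *m H = 0] 1.
Proof.
split=> [e v /= v0 hv|p e w e1 hw wH wc /=].
  rewrite ltnS leqn0 => /eqP e0; rewrite e0 in hv.
  have vE : v = map_mx (@mpolyC n K) (map_mx (mcoeff 0%MM) v).
    apply/rowP => t; rewrite !mxE; apply/mpolyP => k; rewrite mcoeffC.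
    have [->|k0] := eqVneq k 0%MM; first by rewrite mulr1.
    by rewrite mulr0 (dhomog_nemf_coeff (hv t)) // mdeg_eq0.
  move: v0; rewrite vE => /freeH ->.
  by apply/rowP => t; rewrite !mxE.
case: e e1 hw => [//|[//|e]] _ hw.
have [|u hu uE] := vkoszul_exact charK hw wc; first by rewrite addnS.
have [|||| t [ht tZ tE]] := proj2 strandZ p.+1 (e.+1 + d)%N (fun A => u A *m H).
- by rewrite addSn ltnS leq_addl.
- move=> A; split; first by move=> /(proj1 (hu A)) ->; rewrite mul0mx.
  exact: vhomog_mul (proj2 (hu A)).
- by move=> A; rewrite /Z /= -mulmxA HG0 mulmx0.
- by move=> A; rewrite vkoszul_mul uE; exact: wH.
have [||t' ht' t'E] := @kchain_factor p.+2 e d _ _ H t hH.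
- by rewrite addSn in ht.
- by move=> A; apply/strand_exact; exact: tZ.
exists (fun A => u A - vkoszul t' A); split=> [A|A|A] /=.
- have [h1 h2] := hu A; have [h3 h4] := vkoszul_chain ht' A.
  split; first by move=> Ap; rewrite h1 // h3 // subrr.
  by apply: vhomogD => //; apply: vhomogN.
- rewrite mulmxBl -tE -vkoszul_mul.
  apply/eqP; rewrite subr_eq0; apply/eqP; apply: eq_bigr => i _.
  by rewrite t'E.
- by rewrite vkoszulB vkoszulK // subr0 uE.
Qed.

End Syzygies.
End Strand.

(** * The pure resolution of a module of finite length *)
Section PureResolution.
Variables (K : fieldType) (n : nat).
Hypothesis n_gt0 : (0 < n)%N.
Hypothesis charK : [pchar K] =i pred0.
Local Notation S := {mpoly K[n]}.
Variables (d r b0 b1 : nat) (G1 : 'M[S]_(b1, b0)).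
Hypothesis r_gt0 : (0 < r)%N.
Hypothesis hG1 : mxhomog r G1.
Hypothesis G1_inj : forall e (w : 'rV_b1),
  (e <= d)%N -> vhomog e w -> w *m G1 = 0 -> w = 0.
Hypothesis G1_surj : forall e (v : 'rV_b0),
  (d + r <= e)%N -> vhomog e v -> exists w, v = w *m G1.

(** The same diagram chase as in [strand_step], with the image of G1 in place of Z:
    that image contains every vector of degree at least d + r, so it has no Koszul
    homology in the range that matters. The chase lowers the degree by 2, which is
    why surjectivity is wanted from d + r on. *)
Lemma first_strand : linear_strand [set v | v *m G1 = 0] d.+1.
Proof.
split=> [e v v0 hv ed|p e w de hw wG wc]; first exact: (G1_inj ed hv v0).
case: e de hw => [//|[//|e]]; rewrite !ltnS => de hw.
have [|u hu uE] := vkoszul_exact charK hw wc; first by rewrite addnS.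
have hu' : kchain p.+1 (e.+1 + r) (fun A => u A *m G1).
  move=> A; split; first by move=> /(proj1 (hu A)) ->; rewrite mul0mx.
  exact: vhomog_mul (proj2 (hu A)).
have [||t ht tE] := vkoszul_exact charK hu'.
- by move=> A; rewrite vkoszul_mul uE; exact: wG.
- by [].
have [||t' ht' t'E] := @kchain_factor K n p.+2 e r _ _ G1 t hG1.
- by rewrite addSn in ht.
- by move=> A; apply: G1_surj (proj2 (ht A)); rewrite addSn leq_add2r.
exists (fun A => u A - vkoszul t' A); split=> [A|A|A] /=.
- have [h1 h2] := hu A; have [h3 h4] := vkoszul_chain ht' A.
  split; first by move=> Ap; rewrite h1 // h3 // subrr.
  by apply: vhomogD => //; apply: vhomogN.
- rewrite mulmxBl -tE -vkoszul_mul.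
  apply/eqP; rewrite subr_eq0; apply/eqP; apply: eq_bigr => i _.
  by rewrite t'E.
- by rewrite vkoszulB vkoszulK // subr0 uE.
Qed.

(** Ranks and matrix are packed together because each rank is produced by the
    preceding choice of a basis. *)
Record stage := Stage { srow : nat; scol : nat; smx : 'M[S]_(srow, scol) }.

(** The first syzygies jump by d + 1, since G1 is injective up to degree d; the
    strands are linear from then on. *)
Definition sdeg k := if k is k'.+1 then (if k' is _.+1 then 1 else d.+1) else r.

Definition next_stage (s : stage) e : stage :=
  let x := sval (syzygy_basis n_gt0 (smx s) e) in Stage (tagged x).

Fixpoint stages k : stage :=
  if k is k'.+1 then next_stage (stages k') (sdeg k) else Stage G1.

Lemma sdeg_gt0 k : (0 < sdeg k)%N.
Proof. by case: k => [|[|k]]. Qed.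

Definition syzygies k : set 'rV[S]_(srow (stages k)) :=
  [set v | v *m smx (stages k) = 0].

Lemma stages_strand k :
  mxhomog (sdeg k) (smx (stages k)) /\ linear_strand (@syzygies k) (sdeg k.+1).
Proof.
elim: k => [|k [hk sk]]; first by split=> //; exact: first_strand.
rewrite /syzygies [stages k.+1]/= /next_stage.
case: (syzygy_basis _ _ _) => x /= [_ [xh x0] xfree xspan]; split=> //.
by apply: (strand_step charK _ sk xh x0 xfree xspan); exists (sdeg k).
Qed.

Lemma stages_exact k (v : 'rV[S]_(srow (stages k))) :
  v *m smx (stages k) = 0 <-> exists w, v = w *m smx (stages k.+1).
Proof.
have [hk sk] := stages_strand k; move: v sk.
rewrite [stages k.+1]/= /next_stage.
case: (syzygy_basis _ _ _) => x /= [_ [_ x0] _ xspan] v sk.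
by apply: (strand_exact _ sk x0 xspan); exists (sdeg k).
Qed.

Variables (M : gradedModule S) (aug : {linear 'rV[S]_b0 -> M}).
Hypothesis aug_homog : forall t, gpart 0 (aug (delta_mx 0 t)).
Hypothesis aug_surj : forall x : M, exists v, aug v = x.
Hypothesis aug_exact : forall v, aug v = 0 <-> exists w, v = w *m G1.

Fixpoint pure_shift k : nat :=
  if k is k'.+1 then (pure_shift k' + sdeg k')%N else 0%N.

Lemma pure_diff_homog k (s : 'I_(scol (stages k.+1))) (t : 'I_(scol (stages k))) :
  homz ((pure_shift k.+1)%:Z - (pure_shift k)%:Z) (smx (stages k) s t).
Proof.
rewrite /= PoszD addrAC subrr add0r.
exact: (proj1 (stages_strand k)).
Qed.

Definition pure_resolution : gradedFreeResolution M :=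
  @GradedFreeResolution K n M (fun k => scol (stages k))
    (fun k _ => (pure_shift k)%:Z) (fun k => smx (stages k)) aug
    pure_diff_homog (fun t => aug_homog t) aug_surj aug_exact stages_exact.

Lemma pure_resolution_minimal : minimal_resolution pure_resolution.
Proof.
move=> k s t; apply: (dhomog_nemf_coeff (proj1 (stages_strand k) s t)).
by rewrite /= mdeg0 eq_sym -lt0n sdeg_gt0.
Qed.

Local Notation N := (nmon n).

Definition syzygy_dim k e : nat := sval (cid (has_dim_ker n_gt0 (smx (stages k)) e)).

Lemma syzygy_dimP k e :
  has_dim [set v | vhomog e v /\ v *m smx (stages k) = 0] (syzygy_dim k e).
Proof. by rewrite /syzygy_dim; case: cid. Qed.

Lemma syzygy_dim_lt k e : (e < sdeg k.+1)%N -> syzygy_dim k e = 0%N.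
Proof.
move=> ed; apply: has_dim_uniq (syzygy_dimP k e) _.
exists (fun _ => 0); split=> [[]//|c _ []//|x [hx x0]].
exists (fun _ => 0); rewrite big_ord0.
exact: (proj1 (proj2 (stages_strand k)) e).
Qed.

Lemma stage_dim k e l :
  has_dim [set v | exists2 w, vhomog e w & v = w *m smx (stages k)] l ->
  (syzygy_dim k e + l)%N = (srow (stages k) * N e)%N.
Proof.
move=> hl; have [z [l' [<- hz hl']]] := has_dim_linear (mulmxr (smx (stages k)))
  (ksub_vhomog _ _ _ e) (has_dim_vhomog K n_gt0 _ e).
by rewrite (has_dim_uniq (syzygy_dimP k e) hz) (has_dim_uniq hl hl').
Qed.

Lemma first_syzygy_dim s :
  (syzygy_dim 0 (d + s) + b0 * N (d + r + s) = b1 * N (d + s))%N.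
Proof.
rewrite -(@stage_dim 0 (d + s) (b0 * N (d + r + s))) //.
apply: has_dim_ext (has_dim_vhomog K n_gt0 _ _) => v /=; split=> [hv|[w hw ->]].
  have [|w vw] := G1_surj _ hv; first by rewrite leq_addr.
  by apply: (vhomog_factor hG1 _ vw); rewrite addnAC.
by rewrite addnAC; exact: vhomog_mul hw.
Qed.

Lemma syzygy_dim_add k e :
  (syzygy_dim k.+1 e + syzygy_dim k (e + sdeg k.+1) =
   srow (stages k.+1) * N e)%N.
Proof.
apply: stage_dim; apply: has_dim_ext (syzygy_dimP k _) => v /=.
have [hS _] := stages_strand k.+1.
split=> [[hv /stages_exact[w vw]]|[w hw ->]]; first exact: (vhomog_factor hS hv vw).
by split; [exact: vhomog_mul hw | apply/stages_exact; exists w].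
Qed.

Lemma syzygy_dimE k e : (syzygy_dim k.+1 e)%:R =
  \sum_(i < e) (-1) ^+ i * (srow (stages (k.+2 + i)))%:R * (N (e - i.+1))%:R :> rat.
Proof.
elim: e k => [|e IH] k; first by rewrite big_ord0 syzygy_dim_lt.
have := syzygy_dim_add k.+1 e; rewrite /= addn1 => E.
rewrite big_ord_recl /= expr0 mul1r addn0 subn1 /=.
have -> : (syzygy_dim k.+1 e.+1)%:R = (srow (stages k.+2))%:R * (N e)%:R
     - (syzygy_dim k.+2 e)%:R :> rat.
  by rewrite -natrM -E natrD addrAC subrr add0r.
rewrite IH -sumrN; congr (_ + _); apply: eq_bigr => i _.
by rewrite exprS mulN1r !mulNr subSS addnS.
Qed.

(** The alternating sum of the Hilbert functions in degree d + r + s, where the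
    resolved module vanishes. Only finitely many free modules are nonzero in a
    given degree, so the length of the resolution need not be known. *)
Lemma pure_resolution_euler s :
  b1%:R * (N (d + s))%:R - b0%:R * (N (d + r + s))%:R =
  \sum_(i < s) (-1) ^+ i * (frank pure_resolution (i.+2))%:R
    * (N (s - i.+1))%:R :> rat.
Proof.
rewrite -!natrM -first_syzygy_dim natrD addrK.
case: s => [|s]; first by rewrite big_ord0 addn0 syzygy_dim_lt.
have := syzygy_dim_add 0 s; rewrite /= => E.
rewrite (_ : (d + s.+1)%N = (s + d.+1)%N); last lia.
rewrite big_ord_recl /= expr0 mul1r subn1 /=.
have -> : (syzygy_dim 0 (s + d.+1))%:R = (srow (stages 1))%:R * (N s)%:R
     - (syzygy_dim 1 s)%:R :> rat.
  by rewrite -natrM -E natrD addrAC subrr add0r.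
rewrite syzygy_dimE -sumrN; congr (_ + _); apply: eq_bigr => i _.
by rewrite exprS mulN1r !mulNr subSS.
Qed.

End PureResolution.

(** * Betti numbers of a pure resolution *)
Section Interpolation.
Variables (I : finType) (w : I -> rat) (X : I -> nat) (m : nat).
Hypothesis w_bin : forall s, (s <= m)%N -> \sum_i w i * 'C(X i + s, m)%:R = 0.

(** Finite differences in s lower the binomial index by Pascal's rule. *)
Lemma sum_bin_lower t s : (t + s <= m)%N ->
  \sum_i w i * 'C(X i + s, m - t)%:R = 0.
Proof.
elim: t s => [|t IH] s ts; first by rewrite subn0 w_bin.
have E : (m - t)%N = (m - t.+1).+1 by lia.
have h1 : \sum_i w i * 'C(X i + s.+1, m - t)%:R = 0 by apply: IH; lia.
have h0 : \sum_i w i * 'C(X i + s, m - t)%:R = 0 by apply: IH; lia.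
transitivity (\sum_i w i * 'C(X i + s.+1, m - t)%:R
    - \sum_i w i * 'C(X i + s, m - t)%:R); last by rewrite h1 h0 subr0.
rewrite -sumrB; apply: eq_bigr => i _.
by rewrite addnS E binS natrD -mulrBr addrAC subrr add0r.
Qed.

(** These are a basis of the polynomials, adapted to binomial coefficients. *)
Definition ffact_poly k : {poly rat} := \prod_(j < k) ('X - (j%:R)%:P).

Lemma ffact_polyE k x : (ffact_poly k).[x%:R] = (x ^_ k)%:R.
Proof.
elim: k => [|k IH]; first by rewrite /ffact_poly big_ord0 hornerC ffactn0.
rewrite /ffact_poly big_ord_recr /= hornerM -/(ffact_poly k) IH hornerXsubC ffactnSr.
have [kx|xk] := leqP k x; first by rewrite natrM natrB.
by rewrite ffact_small // mul0r mul0n.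
Qed.

Lemma sum_poly_eq0 (q : {poly rat}) : (size q <= m.+1)%N ->
  \sum_i w i * q.[(X i)%:R] = 0.
Proof.
have fact k : (k <= m)%N -> \sum_i w i * (ffact_poly k).[(X i)%:R] = 0.
  move=> km; have := @sum_bin_lower (m - k)%N 0%N.
  rewrite addn0 leq_subr subKn // => /(_ isT) h.
  transitivity ((\sum_i w i * 'C(X i + 0, k)%:R) * k`!%:R); last by rewrite h mul0r.
  rewrite mulr_suml; apply: eq_bigr => i _.
  by rewrite ffact_polyE -bin_ffact natrM addn0 mulrA.
move=> qm; move: qm (leqnn (size q)).
move: {1 3}(size q) => k; elim: k q => [|k IH] q km qk.
  rewrite leqn0 size_poly_eq0 in qk; rewrite (eqP qk) big1 // => i _.
  by rewrite horner0 mulr0.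
have mon : ffact_poly k \is monic by rewrite monic_prod // => j _; rewrite monicXsubC.
have sz : size (ffact_poly k) = k.+1.
  by rewrite /ffact_poly size_prod_XsubC [index_enum _]unlock -enumT size_enum_ord.
have -> : q = (q`_k) *: ffact_poly k + (q - (q`_k) *: ffact_poly k) by rewrite subrKC.
under eq_bigr do rewrite hornerD hornerZ mulrDr mulrCA.
rewrite big_split /= -mulr_sumr fact ?mulr0 ?add0r //.
apply: IH; first exact: ltnW.
apply/leq_sizeP => j; rewrite leq_eqVlt => /orP[/eqP <-|kj].
  rewrite coefB coefZ; have := mon; rewrite monicE lead_coefE sz /= => /eqP ->.
  by rewrite mulr1 subrr.
rewrite nth_default // (leq_trans _ kj) // (leq_trans (size_polyD _ _)) //.
by rewrite size_polyN geq_max qk (leq_trans (size_scale_leq _ _)) ?sz.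
Qed.

End Interpolation.

Lemma prod_above i p : (\prod_(i.+1 <= k < (i + p).+1) (k - i) = p`!)%N.
Proof.
elim: p => [|p IH]; first by rewrite addn0 big_geq.
rewrite addnS big_nat_recr /=; last by rewrite ltnS leq_addr.
by rewrite IH factS mulnC -addnS addKn.
Qed.

Lemma prod_below a p : (\prod_(a <= k < a + p) (a + p - k) = p`!)%N.
Proof.
elim: p a => [|p IH] a; first by rewrite addn0 big_geq.
rewrite big_ltn; last by rewrite -addSnnS leq_addr.
by rewrite addKn factS -addSnnS IH.
Qed.

Lemma prod_shifted D m : (\prod_(2 <= k < m.+2) (D + k.-1) * D`! = (D + m)`!)%N.
Proof.
elim: m => [|m IH]; first by rewrite big_geq // mul1n addn0.
by rewrite big_nat_recr //= mulnAC IH addnS factS mulnC.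
Qed.

(** X k is the top entry of the binomial coefficient that gives the dimension of
    S(- c_k) in degree d + r, where c_k is the k-th shift. The weight w k is the k-th Betti number with its sign. *)
Section PureBetti.
Variables (n d r : nat) (B : nat -> nat).
Hypothesis n_ge2 : (2 <= n)%N.
Local Notation N := (nmon n).
Hypothesis euler : forall s,
  (N (d + r))%:R * (N (d + s))%:R - (N d)%:R * (N (d + r + s))%:R =
  \sum_(i < s) (-1) ^+ i * (B i.+2)%:R * (N (s - i.+1))%:R :> rat.

Let X k := if k is k'.+1 then (if k' is _.+1 then n - k else d + n.-1)%N
           else (d + r + n.-1)%N.
Let w k : rat := if k is k'.+1 then
    (if k' is _.+1 then (-1) ^+ k * (B k)%:R else - (N (d + r))%:R)
  else (N d)%:R.

Lemma nmonE e : N e = 'C(e + n.-1, n.-1).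
Proof. by rewrite /nmon -bin_sub ?leq_addr // addKn. Qed.

Lemma pure_betti_interp (q : {poly rat}) : (size q <= n)%N ->
  \sum_(k < n.+1) w k * q.[(X k)%:R] = 0.
Proof.
move=> qn; apply: (@sum_poly_eq0 _ (fun k : 'I_n.+1 => w k) (fun k : 'I_n.+1 => X k) n.-1);
  last by lia.
move=> s sn; rewrite -(big_mkord predT (fun k => w k * 'C(X k + s, n.-1)%:R)).
rewrite big_ltn // big_ltn; last lia.
rewrite (big_addn 0 _ 2) subSS.
rewrite /= mulNr addrA.
have e0 : 'C(d + r + n.-1 + s, n.-1) = N (d + r + s) by rewrite nmonE addnAC.
have e1 : 'C(d + n.-1 + s, n.-1) = N (d + s) by rewrite nmonE addnAC.
rewrite e0 e1 -[X in X + _]opprB opprB.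
rewrite (@big_cat_nat _ _ _ s) //=; last by lia.
rewrite [X in _ + (_ + X)]big_nat [X in _ + (_ + X)]big1 ?addr0; last first.
  move=> i /andP[si i_n]; rewrite addn2 bin_small ?mulr0 //=; lia.
rewrite big_mkord (_ : \sum_(i < s) _ =
  \sum_(i < s) (-1) ^+ i * (B i.+2)%:R * (N (s - i.+1))%:R).
  by rewrite -euler; ring.
apply: eq_bigr => i _; rewrite addn2 /= !exprS !mulN1r opprK nmonE.
by congr (_ * ('C(_, _))%:R); have := ltn_ord i; lia.
Qed.

(** The Herzog-Kuehl formula: test the relations of [pure_betti_interp] on the
    polynomial that vanishes at all X k except k = 0 and k = i. *)
Lemma pure_betti i : (2 <= i <= n)%N ->
  (B i)%:R = (r * n.-1`! * N d * N (d + r))%:R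
     / ((i - 2)`! * (n - i)`! * (d + r + i).-1 * (d + i).-1)%:R :> rat.
Proof.
move=> /andP[i2 i_n].
pose q : {poly rat} := ('X - ((X 1%N)%:R)%:P) *
  ((\prod_(2 <= k < i) ('X - ((X k)%:R)%:P)) *
   (\prod_(i.+1 <= k < n.+1) ('X - ((X k)%:R)%:P))).
have szq : (size q <= n)%N.
  rewrite /q size_monicM ?monicXsubC ?size_XsubC //; last first.
    by rewrite mulf_neq0 // monic_neq0 // monic_prod // => *; rewrite monicXsubC.
  rewrite size_monicM ?monic_prod //; try by move=> *; rewrite monicXsubC.
    rewrite !size_prod_XsubC !size_iota; lia.
  by rewrite monic_neq0 // monic_prod // => *; rewrite monicXsubC.
have qE x : q.[x] = (x - (X 1%N)%:R) *
    ((\prod_(2 <= k < i) (x - (X k)%:R)) * (\prod_(i.+1 <= k < n.+1) (x - (X k)%:R))).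
  rewrite /q !hornerM !horner_prod hornerXsubC.
  by congr (_ * (_ * _)); apply: eq_bigr => k _; rewrite hornerXsubC.
have q0 k : (0 < k)%N -> (k != i)%N -> (k < n.+1)%N -> q.[(X k)%:R] = 0.
  move=> k0 ki kn; rewrite qE; have [k1|k1] := eqVneq k 1%N.
    by rewrite k1 subrr mul0r.
  have [lt|lt|e] := ltngtP k i; last by rewrite e eqxx in ki.
    rewrite (bigD1_seq k) ?iota_uniq ?mem_index_iota //=; last by lia.
    by rewrite subrr !mul0r mulr0.
  rewrite [X in _ * (_ * X)](bigD1_seq k) ?iota_uniq ?mem_index_iota //=; last by lia.
  by rewrite subrr !(mul0r, mulr0).
have qX0 : q.[(X 0%N)%:R] * ((d + r + i).-1 * (d + r)`!)%:R =
    (r * (d + r + n.-1)`!)%:R.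
  have tail a b : (1 < a)%N -> (b <= n.+1)%N ->
      \prod_(a <= k < b) ((X 0%N)%:R - (X k)%:R) = (\prod_(a <= k < b) (d + r + k.-1)%N)%:R :> rat.
    move=> a1 bn; rewrite natr_prod big_nat [RHS]big_nat; apply: eq_bigr => k kab.
    rewrite -natrB; last by case: k kab => [|[|k]] /=; lia.
    by congr _%:R; case: k kab => [|[|k]] /=; lia.
  rewrite qE !tail //; try lia.
  rewrite -natrB /=; last by lia.
  rewrite -!natrM; congr _%:R; rewrite -(prod_shifted (d + r) n.-1).
  rewrite (@big_cat_nat _ _ _ i 2 n.-1.+2) //=; last by lia.
  rewrite [X in (_ = _ * (_ * X * _))%N]big_ltn; last by lia.
  rewrite (_ : n.-1.+2 = n.+1); last by lia.
  rewrite (_ : (d + r + i).-1 = (d + r + i.-1)%N); last by lia.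
  rewrite (_ : (d + r + n.-1 - (d + n.-1))%N = r); last by lia.
  by rewrite -!mulnA [in LHS](mulnCA (\prod_(i.+1 <= k < n.+1) _)).
have qXi : q.[(X i)%:R] = - ((-1) ^+ i * ((i - 2)`! * (n - i)`! * (d + i).-1)%:R).
  rewrite qE.
  have -> : (X i)%:R - (X 1%N)%:R = - (d + i).-1%:R :> rat.
    rewrite -[LHS]opprB; congr (- _); rewrite -natrB; last by case: (i) i2 => [|[|k]] /=; lia.
    by congr _%:R; case: (i) i2 i_n => [|[|k]] /=; lia.
  have -> : \prod_(i.+1 <= k < n.+1) ((X i)%:R - (X k)%:R) = (n - i)`!%:R :> rat.
    rewrite -(prod_above i) natr_prod subnKC // big_nat [RHS]big_nat.
    apply: eq_bigr => k kab; rewrite -natrB.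
      by congr _%:R; case: (i) i2 kab => [|[|i']] //=; case: k => [|[|k]] /=; lia.
    by case: (i) i2 kab => [|[|i']] //=; case: k => [|[|k]] /=; lia.
  have -> : \prod_(2 <= k < i) ((X i)%:R - (X k)%:R) = (-1) ^+ i * (i - 2)`!%:R :> rat.
    rewrite -(prod_below 2) natr_prod subnKC //.
    have -> : (-1) ^+ i = \prod_(2 <= k < i) (-1) :> rat.
      by rewrite prodr_const_nat -[in LHS](subnK i2) exprD sqrrN expr1n mulr1.
    rewrite -big_split big_nat [RHS]big_nat; apply: eq_bigr => k kab /=.
    rewrite mulN1r -[LHS]opprB; congr (- _); rewrite -natrB.
      by congr _%:R; case: (i) i2 i_n kab => [|[|i']] //=; case: k => [|[|k]] /=; lia.
    by case: (i) i2 i_n kab => [|[|i']] //=; case: k => [|[|k]] /=; lia.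
  by rewrite !natrM; ring.
have := pure_betti_interp szq.
rewrite -(big_mkord predT (fun k => w k * q.[(X k)%:R])).
rewrite big_ltn // (bigD1_seq i) ?iota_uniq ?mem_index_iota //=; last by lia.
rewrite big_nat_cond big1 ?addr0; last first.
  by move=> k /andP[/andP[k0 kn] ki]; rewrite q0 ?mulr0.
rewrite qXi; have -> : w i = (-1) ^+ i * (B i)%:R by case: (i) i2 => [|[|k]].
move=> E.
have s2 : (-1) ^+ i * (-1) ^+ i = 1 :> rat by rewrite -exprMn mulrNN mulr1 expr1n.
have {E s2} Bc : (N d)%:R * q.[(X 0%N)%:R] =
    (B i)%:R * ((i - 2)`! * (n - i)`! * (d + i).-1)%:R.
  have : (N d)%:R * q.[(X 0%N)%:R] - (B i)%:R * ((i - 2)`! * (n - i)`! * (d + i).-1)%:R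
      * ((-1) ^+ i * (-1) ^+ i) = 0 by rewrite -[RHS]E /=; ring.
  by rewrite s2 mulr1 => /eqP; rewrite subr_eq0 => /eqP.
have D0 : ((d + r)`!)%:R != 0 :> rat by rewrite pnatr_eq0 -lt0n fact_gt0.
have i0 : ((i - 2)`!)%:R != 0 :> rat by rewrite pnatr_eq0 -lt0n fact_gt0.
have ni0 : ((n - i)`!)%:R != 0 :> rat by rewrite pnatr_eq0 -lt0n fact_gt0.
have Di0 : (d + r + i).-1%:R != 0 :> rat by rewrite pnatr_eq0; lia.
have di0 : (d + i).-1%:R != 0 :> rat by rewrite pnatr_eq0; lia.
have N1 : (d + r + n.-1)`! = (N (d + r) * n.-1`! * (d + r)`!)%N.
  by rewrite nmonE -mulnA -[LHS](@bin_fact _ n.-1) ?leq_addl // addnK.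
have qX0' : q.[(X 0%N)%:R] = (r * n.-1`! * N (d + r))%:R / (d + r + i).-1%:R.
  apply: (mulIf Di0); rewrite divfK //; apply: (mulIf D0).
  by rewrite -[LHS]mulrA -natrM qX0 N1 !natrM; ring.
move: Bc; rewrite qX0' !natrM => Bc.
apply: (mulIf (mulf_neq0 (mulf_neq0 i0 ni0) di0)); rewrite -Bc.
by field; rewrite i0 ni0 Di0 di0.
Qed.
End PureBetti.

(** * Representations of sl_2 *)

(** B p q plays the role of the bidegree (p, q) part, of weight p - q. *)
Section Sl2.
Variables (K : fieldType) (V : lmodType K).
Hypothesis charK : [pchar K] =i pred0.

Section Commutator.
Variables (E F : {linear V -> V}) (B : nat -> nat -> set V).
Hypothesis BE : forall p q u, B p q.+1 u -> B p.+1 q (E u).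
Hypothesis BE0 : forall p u, B p 0 u -> E u = 0.
Hypothesis BEF : forall p q u, B p q u ->
  E (F u) = F (E u) + (p%:R - q%:R) *: u.

Lemma iter_linear0 k : iter k E 0 = 0.
Proof. by elim: k => //= k ->; rewrite linear0. Qed.

Lemma iter_linearP k a u v : iter k E (a *: u + v) = a *: iter k E u + iter k E v.
Proof. by elim: k => //= k ->; rewrite linearP. Qed.

(** The identity [E^(m+1), F] = (m+1) E^m (H + m), where H is the weight; each step
    of the induction applies the case m = 0 and moves to E u, of weight H + 2. *)
Lemma sl2_commutator p q u m : B p q u ->
  iter m.+1 E (F u) = F (iter m.+1 E u) +
    (m.+1%:R * (p%:R - q%:R + m%:R)) *: iter m E u.
Proof.
elim: m p q u => [|m IH] p q u hu.
  by rewrite /= (BEF hu) mul1r addr0.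
rewrite iterSr (BEF hu) addrC iter_linearP.
case: q hu => [|q] hu.
  rewrite (BE0 hu) linear0 iter_linear0 [iter m.+2 E u]iterSr (BE0 hu).
  rewrite iter_linear0 linear0 addr0 add0r.
  by rewrite iterSr (BE0 hu) iter_linear0 !scaler0.
rewrite (IH _ _ _ (BE hu)) -!iterSr addrCA -scalerDl; congr (_ + _ *: _).
by rewrite -!natr1; ring.
Qed.

End Commutator.

Variables (E F : {linear V -> V}) (B : nat -> nat -> set V).
Hypothesis BE : forall p q u, B p q.+1 u -> B p.+1 q (E u).
Hypothesis BE0 : forall p u, B p 0 u -> E u = 0.
Hypothesis BF : forall p q u, B p.+1 q u -> B p q.+1 (F u).
Hypothesis BF0 : forall q u, B 0 q u -> F u = 0.
Hypothesis BEF : forall p q u, B p q u ->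
  E (F u) = F (E u) + (p%:R - q%:R) *: u.
Hypothesis BZD : forall p q (a : K) u v, B p q u -> B p q v -> B p q (a *: u + v).

(** E^k is injective on the weights at most - k. Induction on p: by the
    commutator formula F u is killed by E^(k+1), so F u = 0; then the same formula
    has a nonzero scalar and lowers k down to 0. *)
Lemma sl2_inj p q k u : (p + k <= q)%N -> B p q u -> iter k E u = 0 -> u = 0.
Proof.
have comm := sl2_commutator BE BE0 BEF.
have desc p' q' k' u' : (p' + k' <= q')%N -> B p' q' u' -> F u' = 0 ->
    iter k' E u' = 0 -> u' = 0.
  move=> + hu Fu; elim: k' => // k' IHk pkq Eu; apply: IHk; first by lia.
  have := comm _ _ _ k' hu; rewrite Fu Eu iter_linear0 linear0 add0r => /esym/eqP.
  rewrite scaler_eq0 => /orP[|/eqP //].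
  rewrite mulf_eq0 (negPf (natK_neq0 charK _)) //= addrAC -natrD -opprB oppr_eq0.
  by rewrite -natrB ?(negPf (natK_neq0 charK _)) //; lia.
elim: p q k u => [|p IH] q k u pkq hu Eu; apply: (desc _ _ _ _ pkq hu) => //.
  exact: BF0 hu.
apply: (IH q.+1 k.+1); [by lia | exact: BF |].
by rewrite (comm _ _ _ _ hu) Eu scaler0 addr0 /= Eu !linear0.
Qed.

(** Induction on q. The image E v is E^(k+1) u, and v - E^k u is then a highest
    weight vector, of weight at least k; on such a vector E^k F^k is a nonzero
    scalar. *)
Lemma sl2_surj p q k v : (k + q <= p)%N -> B p q v ->
  exists2 u, B (p - k)%N (q + k)%N u & v = iter k E u.
Proof.
(* Exchanging E and F gives the commutator formula with F in the first place. *)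
have BFE p' q' u : B q' p' u -> F (E u) = E (F u) + (p'%:R - q'%:R) *: u.
  by move=> hu; rewrite (BEF hu) -addrA -scalerDl addrA subrK subrr scale0r addr0.
have comm := @sl2_commutator F E (fun p q => B q p) (fun p q u => @BF q p u)
  (fun p u => @BF0 p u) BFE.
have BFk p' q' k' u : (k' <= p')%N -> B p' q' u -> B (p' - k')%N (q' + k')%N (iter k' F u).
  elim: k' => [|k' IH] k'p hu; first by rewrite subn0 addn0.
  rewrite /= addnS; apply: BF; rewrite (_ : (p' - k'.+1).+1 = p' - k')%N; last by lia.
  by apply: IH => //; lia.
have BEk p' q' k' u : B p' (q' + k')%N u -> B (p' + k')%N q' (iter k' E u).
  elim: k' p' u => [|k' IH] p' u hu; first by move: hu; rewrite !addn0.
  rewrite iterSr -addSnnS; apply: IH; apply: BE; by rewrite -addnS.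
have highest p' q' k' u : (k' + q' <= p')%N -> B p' q' u -> E u = 0 ->
    exists2 c : K, c != 0 & iter k' E (iter k' F u) = c *: u.
  move=> kqp hu Eu; elim: k' kqp => [|k' IH] kqp.
    by exists 1; rewrite ?oner_neq0 // scale1r.
  have [|c c0 IHE] := IH; first by lia.
  exists (- (k'.+1%:R * (q'%:R - p'%:R + k'%:R)) * c).
    rewrite mulf_neq0 // oppr_eq0 mulf_neq0 ?natK_neq0 //.
    by rewrite addrAC -natrD -opprB oppr_eq0 -natrB ?natK_neq0 //; lia.
  have := comm _ _ _ k' hu; rewrite Eu iter_linear0 => /esym/eqP.
  rewrite addr_eq0 => /eqP e; rewrite iterSr e -scaleNr.
  by rewrite -[_ *: _]addr0 iter_linearP iter_linear0 addr0 IHE scalerA.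
have last_step p' q' k' u' : (k' + q' <= p')%N -> B p' q' u' ->
    (exists2 u, B (p' - k')%N (q' + k')%N u & E (u' - iter k' E u) = 0) ->
    exists2 u, B (p' - k')%N (q' + k')%N u & u' = iter k' E u.
  move=> kqp hu [u Bu Eu].
  have hv : B p' q' (u' - iter k' E u).
    rewrite addrC -scaleN1r; apply: BZD => //.
    by have := BEk _ _ _ _ Bu; rewrite subnK //; lia.
  have [c c0 cE] := highest _ _ _ _ kqp hv Eu.
  exists (c^-1 *: iter k' F (u' - iter k' E u) + u).
    by apply: BZD => //; apply: BFk => //; lia.
  by rewrite iter_linearP cE scalerA mulVf // scale1r subrK.
elim: q p k v => [|q IH] p k v kqp hv; apply: last_step => //.
  have B0 p' q' u : B p' q' u -> B p' q' 0.
    by move=> hu; rewrite -(addNr u) -scaleN1r; apply: BZD.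
  exists 0; last by rewrite iter_linear0 subr0 (BE0 hv).
  by apply: B0 (BFk _ _ _ _ _ hv); lia.
have [|u hu Ev] := IH p.+1 k.+1 (E v) _ (BE hv); first by lia.
exists u; first by rewrite subSS in hu; rewrite addSnnS.
by rewrite linearB /= -iterS -Ev subrr.
Qed.

End Sl2.

(** * The polarization operator on inverse polynomials *)
Section Polarization.
Variables (K : fieldType) (n : nat).
Hypothesis n_gt0 : (0 < n)%N.
Hypothesis charK : [pchar K] =i pred0.
Local Notation S := {mpoly K[n]}.
Local Notation P := {mpoly S[n]}.
Variable l : 'I_n -> K.

(** The function w stands for the formal sum of the w a / y^(a+1). *)
Definition invsys : Type := 'X_{1..n} -> S.
HB.instance Definition _ := GRing.Lmodule.on invsys.
Implicit Types (w : invsys) (a m : 'X_{1..n}) (g : P).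

(** Multiplication by f_l: the variable y_i shifts the exponents. *)
Definition polar w : invsys := fun a => \sum_i l i *: ('X_i * w (a + U_(i))%MM).

(** The operator sum_i l_i^-1 z_i d/dx_i, where y^(-a-1) is read as the divided power
    z^a / a!; multiplying divided powers produces the factor a i. *)
Definition copolar w : invsys :=
  fun a => \sum_i ((l i)^-1 * (a i)%:R) *: (w (a - U_(i))%MM)^`M(i).

Lemma polar_linear : linear polar.
Proof.
move=> c u v; apply/funext => a; rewrite /polar.
have -> : (c *: (polar u) + polar v) a = c *: polar u a + polar v a by [].
rewrite /polar scaler_sumr -big_split; apply: eq_bigr => i _ /=.
by rewrite mulrDr scalerDr -scalerAr !scalerA mulrC.
Qed.
HB.instance Definition _ := GRing.isLinear.Build K invsys invsys _ polar polar_linear.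

Lemma copolar_linear : linear copolar.
Proof.
move=> c u v; apply/funext => a; rewrite /copolar.
have -> : (c *: (copolar u) + copolar v) a = c *: copolar u a + copolar v a by [].
rewrite /copolar scaler_sumr -big_split; apply: eq_bigr => i _ /=.
by rewrite mderivD mderivZ scalerDr !scalerA [c * _]mulrC.
Qed.
HB.instance Definition _ := GRing.isLinear.Build K invsys invsys _ copolar copolar_linear.

Definition bidegree p q : set invsys :=
  [set w | forall a, (mdeg a != q -> w a = 0) /\ w a \is p.-homog].

Lemma bidegreeZD p q (c : K) (u v : invsys) :
  bidegree p q u -> bidegree p q v -> bidegree p q (c *: u + v).
Proof.
move=> hu hv a; have [u1 u2] := hu a; have [v1 v2] := hv a.
have -> : (c *: u + v) a = c *: u a + v a by [].
split; last by rewrite rpredD // rpredZ.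
by move=> aq; rewrite u1 // v1 // scaler0 addr0.
Qed.

Lemma bidegree_polar p q u : bidegree p q.+1 u -> bidegree p.+1 q (polar u).
Proof.
move=> hu a; split=> [aq|].
  rewrite /polar big1 // => i _; rewrite (proj1 (hu _)) ?mulr0 ?scaler0 //.
  by rewrite mdegD mdeg1 addn1.
by rewrite rpred_sum // => i _; rewrite rpredZ // mulXi_homog //; apply: (proj2 (hu _)).
Qed.

Lemma polar_bidegree0 p u : bidegree p 0 u -> polar u = 0.
Proof.
move=> hu; apply/funext => a; rewrite /polar big1 // => i _.
by rewrite (proj1 (hu _)) ?mulr0 ?scaler0 // mdegD mdeg1 addn1.
Qed.

Lemma bidegree_copolar p q u : bidegree p.+1 q u -> bidegree p q.+1 (copolar u).
Proof.
move=> hu a; split=> [aq|].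
  rewrite /copolar big1 // => i _; have [->|ai] := posnP (a i).
    by rewrite mulr0 scale0r.
  rewrite (proj1 (hu _)) ?mderiv0 ?scaler0 //; apply: contraNneq aq => <-.
  by rewrite -addn1 -(mdeg1 i) -mdegD submK // lep1mP -lt0n.
by rewrite rpred_sum // => i _; rewrite rpredZ // (mderiv_homog _ (proj2 (hu _))).
Qed.

Lemma copolar_bidegree0 q u : bidegree 0 q u -> copolar u = 0.
Proof.
move=> hu; apply/funext => a; rewrite /copolar big1 // => i _.
suff -> : (u (a - U_(i))%MM)^`M(i) = 0 by rewrite scaler0.
apply/mpolyP => m; rewrite mcoeff_deriv mcoeff0.
by rewrite (dhomog_nemf_coeff (proj2 (hu _))) ?mul0rn //= mdegD mdeg1 addn1.
Qed.

Hypothesis l_neq0 : forall i, l i != 0.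

(** The terms with i <> j cancel; the diagonal ones give the two Euler operators. *)
Lemma polar_copolar p q u : bidegree p q u ->
  polar (copolar u) = copolar (polar u) + (p%:R - q%:R) *: u.
Proof.
move=> hu; apply/funext => a.
have -> : (copolar (polar u) + (p%:R - q%:R) *: u) a =
  copolar (polar u) a + (p%:R - q%:R) *: u a by [].
apply/eqP; rewrite -subr_eq0 opprD addrA subr_eq0; apply/eqP.
transitivity (\sum_i ('X_i * (u a)^`M(i) - (a i)%:R *: u a)); last first.
  rewrite sumrB (euler_homog (proj2 (hu a))) -scaler_suml -natr_sum -mdegE scalerBl.
  have [-> //|aq] := eqVneq (mdeg a) q.
  by rewrite (proj1 (hu a)) // !scaler0.
have -> : polar (copolar u) a = \sum_i \sum_j l i *: ('X_i *
    (((l j)^-1 * ((a + U_(i))%MM j)%:R) *: (u (a + U_(i) - U_(j))%MM)^`M(j))).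
  by apply: eq_bigr => i _; rewrite mulr_sumr scaler_sumr.
have -> : copolar (polar u) a = \sum_i \sum_j ((l j)^-1 * (a j)%:R) *:
    (l i *: ('X_i * u (a - U_(j) + U_(i))%MM))^`M(j).
  rewrite exchange_big; apply: eq_bigr => j _ /=.
  rewrite -scaler_sumr; congr (_ *: _); exact: linear_sum.
rewrite -sumrB; apply: eq_bigr => i _ /=.
rewrite -sumrB (bigD1 i) //= big1 ?addr0 => [|j ji].
  rewrite mnmDE mnm1E eqxx addmK mderivZ mderivXM eqxx scale1r addn1.
  rewrite -!scalerAr !scalerA mulrA mulfV // mul1r mulrAC mulVf // mul1r.
  have [a0|ai] := posnP (a i).
    by rewrite a0 scale1r !scale0r.
  rewrite submK ?lep1mP -?lt0n // -natr1 scalerDl scale1r scalerDr.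
  by rewrite [X in _ - X]addrC opprD addrA [X in X - _ - _]addrC addrK.
rewrite mnmDE mnm1E eq_sym (negPf ji) addn0 mderivZ mderivXM eq_sym (negPf ji).
rewrite scale0r add0r.
have [a0|aj] := posnP (a j).
  by rewrite a0 !mulr0 !scale0r mulr0 scaler0 subrr.
have -> : (a + U_(i) - U_(j))%MM = (a - U_(j) + U_(i))%MM.
  by rewrite [RHS]addmC addmBA ?lep1mP -?lt0n // [(_ + a)%MM]addmC.
by rewrite -!scalerAr !scalerA [l i * _]mulrC subrr.
Qed.

Lemma polar_inj p q k u : (p + k <= q)%N -> bidegree p q u ->
  iter k polar u = 0 -> u = 0.
Proof.
exact: (sl2_inj charK bidegree_polar polar_bidegree0 bidegree_copolar
  copolar_bidegree0 polar_copolar).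
Qed.

Lemma polar_surj p q k v : (k + q <= p)%N -> bidegree p q v ->
  exists2 u, bidegree (p - k)%N (q + k)%N u & v = iter k polar u.
Proof.
exact: (sl2_surj charK bidegree_polar polar_bidegree0 bidegree_copolar
  copolar_bidegree0 polar_copolar bidegreeZD).
Qed.

End Polarization.

(** * The presentation matrix *)
Section Presentation.
Variables (K : fieldType) (n : nat).
Hypothesis n_gt0 : (0 < n)%N.
Hypothesis charK : [pchar K] =i pred0.
Local Notation S := {mpoly K[n]}.
Local Notation P := {mpoly S[n]}.
Variable l : 'I_n -> K.
Local Notation f := (flambda l).
Local Notation N := (nmon n).
Local Notation invsys := (invsys K n).

Lemma flambda_bihomog k : bihomog k%:Z k%:Z (f ^+ k).
Proof.
elim: k => [|k IH].
  split; first exact: dhomog1.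
  move=> m; rewrite mcoeff1; case: eqP => _; [exact: dhomog1 | exact: rpred0].
rewrite exprS intS; apply: bihomogM IH; split.
  rewrite /= rpred_sum // => i _; rewrite mul_mpolyC rpredZ // dhomogX /=.
  by rewrite mdeg1.
move=> m; rewrite /= raddf_sum rpred_sum // => i _ /=.
rewrite mul_mpolyC mcoeffZ mcoeffX; case: eqP => _; rewrite ?mulr0 ?rpred0 //.
by rewrite mulr1 rpredZ // dhomogX /= mdeg1.
Qed.

(** The action on inverse polynomials of the degree k part of g. *)
Definition contract k (g : P) (w : invsys) : invsys :=
  fun a => \sum_(s < N k) g@_(mono s) * w (a + mono s)%MM.

Lemma contractX k m w a : mdeg m = k -> contract k 'X_[m] w a = w (a + m)%MM.
Proof.
move=> mk; have [s ->] := monoP n_gt0 mk; rewrite /contract (bigD1 s) //=.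
rewrite mcoeffX eqxx mul1r big1 ?addr0 // => t ts.
by rewrite mcoeffX (inj_eq (@mono_inj _ n_gt0 k)) eq_sym (negPf ts) mul0r.
Qed.

Lemma contract_sum k (I : Type) (r : seq I) (Q : pred I) (c : I -> S) (g : I -> P) w a :
  contract k (\sum_(i <- r | Q i) c i *: g i) w a =
  \sum_(i <- r | Q i) c i * contract k (g i) w a.
Proof.
rewrite /contract; under [RHS]eq_bigr do rewrite mulr_sumr.
rewrite exchange_big; apply: eq_bigr => s _ /=.
rewrite raddf_sum mulr_suml; apply: eq_bigr => i _ /=.
by rewrite mcoeffZ mulrA.
Qed.

Lemma contract_mulX k i (g : P) w a : g \is k.-homog ->
  contract k.+1 ('X_i * g) w a = contract k g w (a + U_(i))%MM.
Proof.
move=> /dhomogP hg; rewrite [g in LHS]mpolyE [g in RHS]mpolyE mulr_sumr.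
under eq_bigr do rewrite -scalerAr.
rewrite !contract_sum; apply: eq_big_seq => m /hg /= mk.
by rewrite -mpolyXD !contractX ?addmA // mdegD mdeg1 mk.
Qed.

Lemma contract_polar k w : contract k (f ^+ k) w = iter k (polar l) w.
Proof.
elim: k => [|k IH].
  apply/funext => a; rewrite expr0 -mpolyX0 contractX ?addm0 //.
  exact: mdeg0.
apply/funext => a; rewrite exprS iterS -IH /polar /flambda mulr_suml.
under eq_bigr do rewrite -mulrA mul_mpolyC.
rewrite contract_sum; apply: eq_bigr => i _.
rewrite contract_mulX ?scalerAl //.
exact: (proj1 (flambda_bihomog k)).
Qed.

Definition extend q (w : 'rV[S]_(N q)) : invsys :=
  fun m => \sum_s (mono s == m)%:R * w 0 s.

Lemma extend_mono q (w : 'rV_(N q)) s : extend w (mono s) = w 0 s.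
Proof.
rewrite /extend (bigD1 s) //= eqxx mul1r big1 ?addr0 // => t ts.
by rewrite (inj_eq (@mono_inj _ n_gt0 q)) (negPf ts) mul0r.
Qed.

Lemma extend_bidegree e q (w : 'rV_(N q)) : vhomog e w -> bidegree e q (extend w).
Proof.
move=> hw a; split=> [aq|].
  rewrite /extend big1 // => s _; case: eqP => [e'|_]; last by rewrite mul0r.
  by move: aq; rewrite -e' mdeg_mono // eqxx.
rewrite rpred_sum // => s _; case: eqP => _; last by rewrite mul0r rpred0.
by rewrite mul1r; apply: hw.
Qed.

Lemma extend_row p q (u : invsys) : bidegree p q u ->
  extend (\row_s u (mono s) : 'rV_(N q)) = u.
Proof.
move=> hu; apply/funext => a; have [aq|aq] := eqVneq (mdeg a) q.
  by have [s ->] := monoP n_gt0 aq; rewrite extend_mono mxE.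
rewrite (proj1 (hu a) aq) /extend big1 // => s _.
case: eqP => [e|_]; last by rewrite mul0r.
by move: aq; rewrite -e mdeg_mono // eqxx.
Qed.

Variables d r : nat.

(** Multiplication by f_l^r from the inverse polynomials of degree d + r to those of
    degree d, in the bases y^(-c-1) and y^(-a-1). *)
Definition presentation : 'M[S]_(N (d + r), N d) :=
  \matrix_(c, a) if (mono a <= mono c)%MM then (f ^+ r)@_(mono c - mono a) else 0.

Lemma presentation_homog : mxhomog r presentation.
Proof.
move=> c a; rewrite mxE; case: ifP => _; last exact: rpred0.
exact: (proj2 (flambda_bihomog r)).
Qed.

Lemma presentation_polar (w : 'rV[S]_(N (d + r))) a :
  (w *m presentation) 0 a = iter r (polar l) (extend w) (mono a).
Proof.
rewrite -contract_polar mxE /contract /extend.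
under [RHS]eq_bigr do rewrite mulr_sumr.
rewrite exchange_big; apply: eq_bigr => c _ /=; rewrite mxE.
case: ifP => ac; last first.
  rewrite mulr0 big1 // => s _; case: eqP => [e|_]; last by rewrite mul0r mulr0.
  by move: ac; rewrite e lem_addr.
have [s sE] : exists s : 'I_(N r), (mono c - mono a)%MM = mono s.
  apply: monoP => //; apply/eqP.
  rewrite -(eqn_add2r (mdeg (mono a))) -mdegD submK // !mdeg_mono //.
  by rewrite addnC.
rewrite (bigD1 s) //= -sE [(mono a + _)%MM]addmC submK // eqxx mul1r mulrC.
rewrite big1 ?addr0 // => t ts; case: eqP => [e|_]; last by rewrite mul0r mulr0.
case/eqP: ts; apply: (@mono_inj _ n_gt0 r).
by rewrite -sE e [(mono a + _)%MM]addmC addmK.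
Qed.

Hypothesis l_neq0 : forall i, l i != 0.

Lemma presentation_inj e (w : 'rV_(N (d + r))) :
  (e <= d)%N -> vhomog e w -> w *m presentation = 0 -> w = 0.
Proof.
move=> ed hw w0; have hw' := extend_bidegree hw.
suff E : extend w = 0 by apply/rowP => s; rewrite -extend_mono E mxE.
apply: (@polar_inj K n charK l l_neq0 e (d + r) r) => //; first by rewrite leq_add2r.
apply/funext => a; have [ad|ad] := eqVneq (mdeg a) d.
  by have [s ->] := monoP n_gt0 ad; rewrite -presentation_polar w0 mxE.
have h k p q (u : invsys) : bidegree p (q + k)%N u ->
    bidegree (p + k)%N q (iter k (polar l) u).
  elim: k p u => [|k IH] p u hu; first by move: hu; rewrite !addn0.
  rewrite iterSr -addSnnS; apply: IH; apply: bidegree_polar.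
  by rewrite -addnS.
exact: (proj1 (h _ _ _ _ hw' a)).
Qed.

Lemma presentation_surj e (v : 'rV_(N d)) :
  (d + r <= e)%N -> vhomog e v -> exists w, v = w *m presentation.
Proof.
move=> de hv; have hv' := extend_bidegree hv.
have [|u hu vu] := polar_surj charK l_neq0 _ hv' (k := r); first by rewrite addnC.
exists (\row_s u (mono s)); apply/rowP => a.
by rewrite presentation_polar (extend_row hu) -vu extend_mono.
Qed.

End Presentation.

(** * The top Cech cohomology module *)
Lemma qproj_eq0 (A : nzRingType) (V : lmodType A) (W : submodClosed V) (v : V) :
  qproj W v = 0 <-> v \in W.
Proof.
have -> : 0 = qproj W 0 by have := @qprojZ _ _ W 0 0; rewrite !scale0r => ->.
by rewrite -[v in v \in W]subr0; exact: qproj_eq.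
Qed.

Lemma mul_expr_denominator (A : comNzRingType) (p q a : A) (c k : nat) : (c <= k)%N ->
  (p * q) ^+ (k - c) * (a * q ^+ c) = q ^+ k * (a * p ^+ (k - c)).
Proof.
move=> ck; rewrite -{2}(subnK ck) exprD exprMn.
by move: (p ^+ _) (q ^+ _) (q ^+ c) => u v w; ring.
Qed.

Section TopCech.
Variables (A : comNzRingType) (M : lmodType A) (n : nat) (y : 'I_n -> A).
Local Notation frac := (@Defs.frac A M).
Local Notation Y := (yprod y (finset.setTfor 'I_n)).
Local Notation T := (finset.setTfor 'I_n).

Lemma frac0 s k : frac s (0 : M) k = 0.
Proof. by rewrite -(scale0r 0) -fracZ scale0r. Qed.

Lemma fracDl s (x x' : M) k : frac s (x + x') k = frac s x k + frac s x' k.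
Proof.
rewrite fracD; apply/frac_eq; exists 0%N.
by rewrite -scalerDr [RHS]scalerA -exprD add0n.
Qed.

Lemma frac_sum s (I : Type) (r : seq I) (Q : pred I) (F : I -> M) k :
  frac s (\sum_(i <- r | Q i) F i) k = \sum_(i <- r | Q i) frac s (F i) k.
Proof.
elim: r => [|i r IH]; first by rewrite !big_nil frac0.
by rewrite !big_cons; case: ifP => _; rewrite ?fracDl IH.
Qed.

Lemma frac_expand s (x : M) k e : frac s x k = frac s (s ^+ e *: x) (k + e).
Proof.
by apply/frac_eq; exists 0%N; rewrite scalerA -exprD add0n.
Qed.

Lemma locmap0 s u t : t = s * u -> locmap u t (0 : loc M s) = 0.
Proof.
by move=> tE; rewrite -(frac0 s 0) (locmapE tE) scaler0 frac0.
Qed.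

Definition topcochain (x : M) (t : nat) : cochain M y :=
  fun S => if S == T then frac (yprod y S) x t else 0.

Lemma setD1_neqT (S : {set 'I_n}) i : i \in S -> (S :\ i == T) = false.
Proof. by apply: contraTF => /eqP/finset.setP/(_ i); rewrite !inE eqxx. Qed.

Lemma topcochain_cocycle x t : cocycle_pred n (topcochain x t).
Proof.
apply/asboolP; split=> [S|].
  by rewrite /topcochain; have [->|//] := eqVneq S T; rewrite cardsT card_ord eqxx.
apply: functional_extensionality_dep => S; rewrite /cech_diff big1 // => i iS.
by rewrite /topcochain setD1_neqT // (locmap0 (yprodD1 y iS)) scaler0.
Qed.

(** The class of the fraction x / (y_1 ... y_n)^t. *)
Definition topclass (x : M) t : cech_cohomology M y n :=
  qproj _ (Cocycle (topcochain_cocycle x t)).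

Lemma topclass_frac x t x' t' : frac Y x t = frac Y x' t' ->
  topclass x t = topclass x' t'.
Proof.
move=> e; rewrite /topclass; congr (qproj _ _); apply: val_inj.
apply: functional_extensionality_dep => S /=; rewrite /topcochain.
by case: eqP => // ->.
Qed.

Lemma topclass_eq x t x' t' k : Y ^+ (k + t') *: x = Y ^+ (k + t) *: x' ->
  topclass x t = topclass x' t'.
Proof. by move=> e; apply: topclass_frac; apply/frac_eq; exists k. Qed.

Lemma topclassP (z : cocycle M y n) x t : val z T = frac Y x t ->
  qproj _ z = topclass x t.
Proof.
move=> e; rewrite /topclass; congr (qproj _ _); apply: val_inj.
have /asboolP[z0 _] := valP z.
apply: functional_extensionality_dep => S /=; rewrite /topcochain.
have [->|ST] := eqVneq S T; first exact: e.
apply: z0.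
by apply: contra ST => /eqP Sn; rewrite eqEcard finset.subsetT cardsT card_ord Sn leqnn.
Qed.

Lemma topclassZD (a : A) x x' t :
  topclass (a *: x + x') t = a *: topclass x t + topclass x' t.
Proof.
rewrite -qprojZ -qprojD; congr (qproj _ _); apply: val_inj.
apply: functional_extensionality_dep => S /=.
have -> : (a *: topcochain x t + topcochain x' t) S =
  a *: topcochain x t S + topcochain x' t S by [].
rewrite /topcochain; case: eqP => _; last by rewrite scaler0 addr0.
by rewrite fracDl fracZ.
Qed.

Lemma topclass0 t : topclass 0 t = 0.
Proof.
have := topclassZD (-1) 0 0 t.
by rewrite scaler0 addr0 scaleN1r addNr.
Qed.

(** The boundaries are the sums over i of fractions without y_i in the denominator.
    Over the common denominator Y^(k+t) the numerator of the i-th one is divisible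
    by y_i^(k+t). *)
Lemma topclass_eq0P x t :
  topclass x t = 0 <-> exists k (m : 'I_n -> M),
    Y ^+ k *: x = \sum_i y i ^+ (k + t) *: m i.
Proof.
pose sgn (i : 'I_n) : A := (-1) ^+ #|[set j in T | (j < i)%N]|.
have sgn2 i : sgn i * sgn i = 1 by rewrite -exprMn mulrNN mulr1 expr1n.
have Yi i : Y = yprod y (T :\ i) * y i by apply: yprodD1; rewrite inE.
split.
  move=> /qproj_eq0/asboolP[b b0 /= db].
  have {db} := congr1 (fun c : cochain M y => c T) db.
  rewrite /topcochain eqxx => bT.
  (* A common denominator for the components of b. *)
  pose K := (\sum_i den (b (T :\ i)))%N.
  have Ki i : (den (b (T :\ i)) <= K)%N by rewrite /K (bigD1 i) //= leq_addr.
  pose m i := sgn i *: (yprod y (T :\ i) ^+ (K - den (b (T :\ i))) *: num (b (T :\ i))).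
  have bE i : sgn i *: locmap (y i) Y (b (T :\ i)) = frac Y (y i ^+ K *: m i) K.
    rewrite -{1}(fracK (b (T :\ i))) (locmapE (Yi i)) fracZ.
    rewrite (frac_expand _ _ _ (K - den (b (T :\ i)))) subnKC //; congr (frac _ _ _).
    rewrite /m !scalerA -!mulrA; congr (_ *: _).
    by rewrite [Y in LHS](Yi i); exact: mul_expr_denominator.
  have : frac Y x t = frac Y (\sum_i y i ^+ K *: m i) K.
    rewrite -bT frac_sum; apply: eq_big => [i|i _]; first by rewrite inE.
    exact: bE.
  move=> /frac_eq[u e]; exists (u + K)%N, (fun i => (yprod y (T :\ i)) ^+ (u + t) *: m i).
  rewrite e scaler_sumr; apply: eq_bigr => i _; rewrite !scalerA; congr (_ *: _).
  by rewrite [Y in LHS](Yi i) exprMn; congr (_ * _ * _);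
    rewrite -mulrA -exprD mulrC addnAC.
move=> [k [m e]]; apply/qproj_eq0/asboolP.
pose b : cochain M y := fun S => \sum_i
  (if S == T :\ i then sgn i *: frac (yprod y S) (m i) (k + t) else 0).
have bT i : b (T :\ i) = sgn i *: frac (yprod y (T :\ i)) (m i) (k + t).
  rewrite /b (bigD1 i) //= eqxx big1 ?addr0 // => j ji.
  by case: eqP => // /finset.setP/(_ j); rewrite !inE eqxx ji.
exists b => [S Sn|].
  rewrite /b big1 // => i _; case: eqP => // Si; case/eqP: Sn.
  by have := cardsD1 i T; rewrite inE -Si cardsT card_ord add1n => <-.
apply: functional_extensionality_dep => S /=; rewrite /topcochain /cech_diff.
have [->|ST] := eqVneq S T; last first.
  rewrite big1 // => i iS; rewrite [b _](_ : _ = 0) ?(locmap0 (yprodD1 y iS)) ?scaler0 //.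
  rewrite /b big1 // => j _; case: eqP => // e'; case/eqP: ST.
  apply/eqP; rewrite eqEcard finset.subsetT /=.
  by rewrite (cardsD1 i S) iS e' [leqLHS](cardsD1 j T) inE.
rewrite (frac_expand _ x t k) e frac_sum.
apply: eq_big => [i|i _]; first by rewrite inE.
rewrite bT [sgn i *: _]fracZ (locmapE (Yi i)) fracZ addnC.
by congr (frac _ _ _); rewrite !scalerA; congr (_ *: _); rewrite -/(sgn i) mulrAC sgn2 mul1r.
Qed.

End TopCech.

(** * Residues of fractions *)
Section MonomialCoefficients.
Variables (R : comNzRingType) (n : nat).
Implicit Types (p : {mpoly R[n]}) (m k : 'X_{1..n}).

Lemma mcoeff_mulX p m k :
  (p * 'X_[m])@_k = if (m <= k)%MM then p@_(k - m) else 0.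
Proof.
case: ifP => mk; first by rewrite -{1}(submK mk) addmC mcoeffMX.
apply/eqP; rewrite mcoeff_eq0; apply/negP; rewrite (perm_mem (msuppMX _ _)).
by move=> /mapP[m' _ e]; move: mk; rewrite e lem_addr.
Qed.

Definition cst t : 'X_{1..n} := [multinom t | _ < n].

Lemma cstE t i : cst t i = t.
Proof. by rewrite mnmE. Qed.

Lemma mdeg_cst t : mdeg (cst t) = (t * n)%N.
Proof.
rewrite mdegE; under eq_bigr do rewrite cstE.
by rewrite sum_nat_const card_ord mulnC.
Qed.

Lemma lem_cst m t : (mdeg m <= t)%N -> (m <= cst t)%MM.
Proof.
move=> mt; apply/mnm_lepP => i; rewrite cstE (leq_trans _ mt) //.
by rewrite mdegE (bigD1 i) //= leq_addr.
Qed.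

End MonomialCoefficients.
Arguments cst {n} t.

Section Residue.
Variables (K : fieldType) (n : nat).
Hypothesis n_gt0 : (0 < n)%N.
Local Notation S := {mpoly K[n]}.
Local Notation P := {mpoly S[n]}.
Local Notation N := (nmon n).

Lemma homog_mono_sum k (p : P) : p \is k.-homog ->
  p = \sum_(s < N k) p@_(mono s) *: 'X_[mono s].
Proof.
move=> hp; apply/mpolyP => m; rewrite raddf_sum /=.
have [mk|mk] := eqVneq (mdeg m) k.
  have [s ->] := monoP n_gt0 mk; rewrite (bigD1 s) //= mcoeffZ mcoeffX eqxx mulr1.
  rewrite big1 ?addr0 // => t ts.
  by rewrite mcoeffZ mcoeffX (inj_eq (@mono_inj _ n_gt0 k)) (negPf ts) mulr0.
rewrite (dhomog_nemf_coeff hp mk) big1 // => s _; rewrite mcoeffZ mcoeffX.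
by case: eqP => [e|_]; rewrite ?mulr0 //; move: mk; rewrite -e mdeg_mono ?eqxx.
Qed.

(** The coefficients of the y^(-a-1), |a| = q, in the fraction p / (y_1 ... y_n)^t;
    the exponents of p are t - (a + 1), and [cst 1] is the exponent of y_1 ... y_n. *)
Definition residue q (p : P) t : 'rV[S]_(N q) :=
  \row_a (if (mono a + cst 1 <= cst t)%MM then p@_(cst t - (mono a + cst 1)) else 0).

Lemma residueZD q (c : S) p p' t :
  residue q (c *: p + p') t = c *: residue q p t + residue q p' t.
Proof.
apply/rowP => a; rewrite !mxE; case: ifP => _; last by rewrite mulr0 addr0.
by rewrite mcoeffD mcoeffZ.
Qed.

Lemma residue0 q t : residue q 0 t = 0.
Proof. by apply/rowP => a; rewrite !mxE mcoeff0 if_same. Qed.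

Lemma residueD q p p' t : residue q (p + p') t = residue q p t + residue q p' t.
Proof. by rewrite -[p]scale1r residueZD !scale1r. Qed.

Lemma residue_sum q (I : Type) (s : seq I) (Q : pred I) (F : I -> P) t :
  residue q (\sum_(i <- s | Q i) F i) t = \sum_(i <- s | Q i) residue q (F i) t.
Proof.
elim: s => [|i s IH]; first by rewrite !big_nil residue0.
by rewrite !big_cons; case: ifP => _; rewrite ?residueD IH.
Qed.

(** A fraction whose denominator can do without y_i has no pole along y_i. *)
Lemma residue_mulXn q (p : P) i t : residue q ('X_i ^+ t * p) t = 0.
Proof.
apply/rowP => a; rewrite !mxE; case: ifP => // /mnm_lepP at'.
rewrite mulrC mpolyXn mcoeff_mulX; case: ifP => // /mnm_lepP/(_ i).
have := at' i; rewrite !(mnmDE, mnmBE, cstE, mulmnE, mnm1E) eqxx; lia.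
Qed.

(** The numerator of the sum of the v_a y^(-a-1) over (y_1 ... y_n)^(q+1). *)
Definition aug_num q (v : 'rV[S]_(N q)) : P := \sum_a v 0 a *: 'X_[cst q - mono a].

Lemma mono_le_cst q t (a : 'I_(N q)) : (q <= t)%N -> (mono a <= cst t)%MM.
Proof. by move=> qt; apply: lem_cst; rewrite mdeg_mono. Qed.

Lemma mono_lt_cst q t (a : 'I_(N q)) : (q < t)%N -> (mono a + cst 1 <= cst t)%MM.
Proof.
case: t => // t; rewrite ltnS => qt; have /mnm_lepP h := mono_le_cst a qt.
by apply/mnm_lepP => i; have := h i; rewrite mnmDE !cstE; lia.
Qed.

Lemma residue_aug_num q (v : 'rV[S]_(N q)) k :
  residue q ('X_[cst k] * aug_num v) (k + q.+1) = v.
Proof.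
apply/rowP => a; rewrite mxE mono_lt_cst ?leq_addl //.
have /mnm_lepP aq := mono_le_cst a (leqnn q).
rewrite mulrC (_ : (cst (k + q.+1) - _)%MM = (cst k + (cst q - mono a))%MM); last first.
  apply/mnmP => i; have := aq i; rewrite !(mnmDE, mnmBE, cstE); lia.
rewrite mcoeffMX /aug_num raddf_sum (bigD1 a) //= mcoeffZ mcoeffX eqxx mulr1.
rewrite big1 ?addr0 // => b ba; rewrite mcoeffZ mcoeffX; case: eqP => [e|_]; last exact: mulr0.
case/eqP: ba; apply: (@mono_inj _ n_gt0 q); apply/mnmP => i.
have /mnm_lepP bq := mono_le_cst b (leqnn q).
by have := aq i; have := bq i; have /mnmP/(_ i) := e; rewrite !(mnmBE, cstE); lia.
Qed.

Variables (l : 'I_n -> K) (d r : nat).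

Lemma presentation_extend (w : 'rV[S]_(N (d + r))) a :
  (w *m presentation l d r) 0 a =
  \sum_(s < N r) (flambda l ^+ r)@_(mono s) * extend w (mono a + mono s)%MM.
Proof. by rewrite presentation_polar // -contract_polar. Qed.

Lemma residue_mul_flambda (h : P) t :
  residue d (h * flambda l ^+ r) t = residue (d + r) h t *m presentation l d r.
Proof.
apply/rowP => a; rewrite presentation_extend mxE.
have ext s : extend (residue (d + r) h t) (mono a + mono s)%MM =
    if (mono a + mono (s : 'I_(N r)) + cst 1 <= cst t)%MM
    then h@_(cst t - (mono a + mono s + cst 1)) else 0.
  have [c cE] : exists c : 'I_(N (d + r)), (mono a + mono s)%MM = mono c.
    by apply: monoP => //; rewrite mdegD !mdeg_mono.
  by rewrite cE extend_mono // mxE.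
case: ifP => at'; last first.
  rewrite big1 // => s _; rewrite ext ifF ?mulr0 //; apply: contraFF at' => /mnm_lepP h'.
  by apply/mnm_lepP => i; have := h' i; rewrite !mnmDE; lia.
rewrite {1}(homog_mono_sum (proj1 (flambda_bihomog l r))) mulr_sumr raddf_sum.
apply: eq_bigr => s _ /=; rewrite -scalerAr mcoeffZ mcoeff_mulX ext; congr (_ * _).
have -> : (mono s <= cst t - (mono a + cst 1))%MM = (mono a + mono s + cst 1 <= cst t)%MM.
  move/mnm_lepP: at' => at'.
  by apply/mnm_lepP/mnm_lepP => h' i; have := h' i; have := at' i;
    rewrite !(mnmDE, mnmBE, cstE); lia.
by case: ifP => // _; rewrite submDA -!addmA [(cst 1 + _)%MM]addmC.
Qed.

End Residue.

(** * The local cohomology of P / f^r as a cokernel *)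
Section LocalCohomologyPresentation.
Variables (K : fieldType) (n : nat).
Hypothesis n_gt0 : (0 < n)%N.
Local Notation S := {mpoly K[n]}.
Local Notation P := {mpoly S[n]}.
Local Notation N := (nmon n).
Variables (l : 'I_n -> K) (d r : nat).
Local Notation g := (flambda l ^+ r).
Local Notation R := (cyclic_module g).
Local Notation G := (presentation l d r).

Definition qcyc (p : P) : cyclic_carrier g := qproj _ (p : P^o).

Lemma qcycZD a p q : qcyc (a * p + q) = a *: qcyc p + qcyc q.
Proof. by rewrite /qcyc -qprojZ -qprojD. Qed.

Lemma qcyc0 : qcyc 0 = 0.
Proof. by have := qcycZD (-1) 0 0; rewrite mulr0 addr0 scaleN1r addNr. Qed.

Lemma qcycZ a p : a *: qcyc p = qcyc (a * p).
Proof. by rewrite -[a * p]addr0 qcycZD qcyc0 addr0. Qed.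

Lemma qcyc_eq0 p : qcyc p = 0 <-> exists h, p = h * g.
Proof. by rewrite /qcyc qproj_eq0; split=> /asboolP. Qed.

Lemma qcycP x : exists p, x = qcyc p.
Proof. by have [p ->] := qprojP x; exists p. Qed.

Lemma qcyc_sum (I : Type) (s : seq I) (Q : pred I) (F : I -> P) :
  qcyc (\sum_(i <- s | Q i) F i) = \sum_(i <- s | Q i) qcyc (F i).
Proof.
elim: s => [|i s IH]; first by rewrite !big_nil qcyc0.
rewrite !big_cons; case: ifP => _ //.
by rewrite -[F i]mul1r qcycZD IH scale1r mul1r.
Qed.

Definition cls (p : P) t : cech_cohomology R (@yvar K n) n := topclass (@yvar K n) (qcyc p) t.

Lemma clsZD a p q t : cls (a * p + q) t = a *: cls p t + cls q t.
Proof. by rewrite /cls qcycZD topclassZD. Qed.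

Lemma cls0 t : cls 0 t = 0.
Proof. by rewrite /cls qcyc0 topclass0. Qed.

Lemma cls_sum (I : Type) (s : seq I) (Q : pred I) (c : I -> S) (F : I -> P) t :
  cls (\sum_(i <- s | Q i) c i *: F i) t =
  \sum_(i <- s | Q i) (c i)%:MP *: cls (F i) t.
Proof.
elim: s => [|i s IH]; first by rewrite !big_nil cls0.
by rewrite !big_cons; case: ifP => _ //; rewrite -mul_mpolyC clsZD IH.
Qed.

Lemma yprodT : yprod (@yvar K n) (finset.setTfor 'I_n) = 'X_[cst 1].
Proof.
rewrite /yprod [RHS]mpolyXE_id; apply: eq_big => [i|i _]; first by rewrite inE.
by rewrite cstE expr1.
Qed.

Lemma yprodTX k : yprod (@yvar K n) (finset.setTfor 'I_n) ^+ k = 'X_[cst k].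
Proof.
by rewrite yprodT mpolyXn; congr 'X_[_]; apply/mnmP => i; rewrite mulmnE !cstE mul1n.
Qed.

Lemma cls_eq p t p' t' : 'X_[cst t'] * p = 'X_[cst t] * p' -> cls p t = cls p' t'.
Proof.
by move=> e; apply: (@topclass_eq _ _ _ _ _ _ _ _ 0%N); rewrite !yprodTX !qcycZ e.
Qed.

Lemma cls_mulg h t : cls (h * g) t = 0.
Proof. by rewrite /cls (proj2 (qcyc_eq0 _)) ?topclass0 //; exists h. Qed.

Lemma cls_eq0 p t : cls p t = 0 -> exists k m h,
  'X_[cst k] * p = \sum_i 'X_i ^+ (k + t) * m i + h * g.
Proof.
move=> /topclass_eq0P[k [m e]]; have [m' mE] := choice (fun i => qcycP (m i)).
have : qcyc ('X_[cst k] * p - \sum_i 'X_i ^+ (k + t) * m' i) = 0.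
  rewrite addrC -mulN1r qcycZD scaleN1r qcyc_sum -qcycZ -yprodTX e addrC.
  by apply/eqP; rewrite subr_eq0; apply/eqP; apply: eq_bigr => i _; rewrite mE qcycZ.
by move=> /qcyc_eq0[h hE]; exists k, m', h; rewrite -hE subrKC.
Qed.

Lemma cls_Xge (m : 'X_{1..n}) t i : (t <= m i)%N -> cls 'X_[m] t = 0.
Proof.
move=> tm; apply/topclass_eq0P; exists 0%N,
  (fun j => if j == i then qcyc 'X_[m - U_(i) *+ t] else 0).
rewrite (bigD1 i) //= eqxx big1 ?addr0; last first.
  by move=> j /negPf->; rewrite scaler0.
rewrite expr0 scale1r add0n /yvar mpolyXn qcycZ -mpolyXD; congr (qcyc 'X_[_]).
apply/mnmP => j; rewrite mnmDE mnmBE mulmnE mnm1E.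
by case: eqP => [<-|_]; [rewrite mul1n subnKC | rewrite mul0n add0n subn0].
Qed.

(** The class of the sum of the v_a y^(-a-1). *)
Definition aug_val (v : 'rV[S]_(N d)) := cls (aug_num v) d.+1.

Lemma aug_valE v : aug_val v = \sum_a (v 0 a)%:MP *: cls 'X_[cst d - mono a] d.+1.
Proof. by rewrite /aug_val cls_sum. Qed.

Lemma aug_valZD a u v : aug_val (a *: u + v) = a%:MP *: aug_val u + aug_val v.
Proof.
rewrite !aug_valE scaler_sumr -big_split; apply: eq_bigr => i _ /=.
by rewrite !mxE mpolyCD mpolyCM scalerDl scalerA.
Qed.

Lemma aug_val0 : aug_val 0 = 0.
Proof. by rewrite aug_valE big1 // => a _; rewrite mxE mpolyC0 scale0r. Qed.

Lemma cls_monomial m t : (mdeg m + n + d = t * n)%N ->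
  cls 'X_[m] t = aug_val (residue d 'X_[m] t).
Proof.
move=> md; have [mt|] := boolP [forall i, m i < t]%N; last first.
  rewrite negb_forall => /existsP[i]; rewrite -leqNgt => tm.
  rewrite (cls_Xge tm) (_ : residue _ _ _ = 0) ?aug_val0 //.
  apply/rowP => a; rewrite !mxE; case: ifP => // /mnm_lepP/(_ i) h.
  rewrite mcoeffX; case: eqP => // /mnmP/(_ i).
  by move: h; rewrite !(mnmDE, mnmBE, cstE); lia.
move/forallP in mt.
have [a aE] : exists a : 'I_(N d), (cst t - (m + cst 1))%MM = mono a.
  apply: monoP => //.
  have e : (cst t - (m + cst 1) + (m + cst 1) = cst t)%MM.
    by apply: submK; apply/mnm_lepP => i; have := mt i; rewrite mnmDE !cstE; lia.
  by have /(congr1 mdeg) := e; rewrite !mdegD !mdeg_cst; lia.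
have rE b : (residue d 'X_[m] t : 'rV[S]_(N d)) 0 b = (b == a)%:R.
  rewrite mxE; have [->|ba] := eqVneq b a.
    rewrite -aE; case: ifPn => [h|/mnm_lepP[]].
      rewrite mcoeffX (_ : _ == _) //; apply/eqP/mnmP => i.
      by have := mt i; rewrite !(mnmDE, mnmBE, cstE); lia.
    by move=> i; have := mt i; rewrite !(mnmDE, mnmBE, cstE); lia.
  case: ifP => // /mnm_lepP h; rewrite mcoeffX; case: eqP => // e.
  case/eqP: ba; apply: (@mono_inj _ n_gt0 d); rewrite -aE; apply/mnmP => i.
  have /mnmP/(_ i) := e; have := h i; have := mt i.
  by rewrite !(mnmDE, mnmBE, cstE); lia.
rewrite aug_valE (bigD1 a) //= rE eqxx mpolyC1 scale1r big1 ?addr0; last first.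
  by move=> b /negPf ba; rewrite rE ba mpolyC0 scale0r.
apply: cls_eq; rewrite -!mpolyXD; congr 'X_[_]; rewrite -aE; apply/mnmP => i.
have /mnm_lepP/(_ i) := mono_le_cst n_gt0 a (leqnn d); rewrite -aE.
by have := mt i; rewrite !(mnmDE, mnmBE, cstE); lia.
Qed.

(** In the y-degree - n - d a fraction is determined by its polar part. By linearity
    this is a statement on monomials: one with an exponent at least t is a
    boundary, the others are the y^(-a-1). *)
Lemma cls_residue k (p : P) t : p \is k.-homog -> (k + n + d = t * n)%N ->
  cls p t = aug_val (residue d p t).
Proof.
move=> /dhomogP hp kt; rewrite [p]mpolyE cls_sum residue_sum.
have aug_sum (s : seq 'X_{1..n}) F : aug_val (\sum_(m <- s) F m) = \sum_(m <- s) aug_val (F m).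
  elim: s => [|m s IH]; first by rewrite !big_nil aug_val0.
  by rewrite !big_cons -[F m]scale1r aug_valZD IH mpolyC1 !scale1r.
rewrite aug_sum; apply: eq_big_seq => m /hp /= mk.
rewrite cls_monomial ?mk // -[_ *: 'X_[m]]addr0 residueZD residue0 aug_valZD.
by rewrite aug_val0 addr0.
Qed.

(** If the class of v vanishes, taking residues in the relation of [cls_eq0] leaves
    only the multiple of f^r. Conversely v = w *m G is the residue of a multiple
    of f^r, whose class is zero. *)
Lemma aug_val_eq0 v : aug_val v = 0 <-> exists w, v = w *m G.
Proof.
split=> [/cls_eq0[k [m [h e]]]|[w ->]].
  exists (residue (d + r) h (k + d.+1)).
  rewrite -residue_mul_flambda // -[LHS](residue_aug_num n_gt0 v k) e residueD.
  by rewrite residue_sum big1 ?add0r // => i _; rewrite residue_mulXn.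
pose h := 'X_[cst 0] * aug_num w.
have := residue_aug_num n_gt0 w 0; rewrite add0n -/h => <-.
rewrite -residue_mul_flambda // -(@cls_residue (((d + r) * n - (d + r)) + r)%N).
- exact: cls_mulg.
- apply: dhomogM; last exact: (proj1 (flambda_bihomog l r)).
  rewrite /h -[((_ * _) - _)%N]add0n; apply: dhomogM.
    by rewrite dhomogX /= mdeg_cst mul0n.
  rewrite rpred_sum // => a _; rewrite rpredZ // dhomogX /=.
  apply/eqP; have := mono_le_cst n_gt0 a (leqnn _) => /submK/(congr1 mdeg).
  by rewrite mdegD mdeg_mono // mdeg_cst; lia.
- have : (d + r <= (d + r) * n)%N by rewrite leq_pmulr.
  by rewrite mulSn; lia.
Qed.

End LocalCohomologyPresentation.

(** The maps above, read with the bigrading and corestricted to the component of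
    degree j = - n - d. *)
Section GradedComponent.
Variables (K : fieldType) (n : nat).
Hypothesis n_gt0 : (0 < n)%N.
Local Notation S := {mpoly K[n]}.
Local Notation P := {mpoly S[n]}.
Local Notation N := (nmon n).
Variables (l : 'I_n -> K) (d r : nat).
Local Notation g := (flambda l ^+ r).
Local Notation LC := (local_cohomology (cyclic_module g) n).
Local Notation j := (- (n + d)%:Z).
Local Notation G := (presentation l d r).
Local Notation aug_val := (@aug_val K n l d r).
Implicit Types v : 'rV[S]_(N d).

Lemma homz_coef i (p : S) (b : bool) : homz i p -> homz i (p * b%:R).
Proof. by case: b => hp; rewrite ?mulr1 ?mulr0 // homz0. Qed.

Lemma aug_num_bihomog i v : (forall a, homz i (v 0 a)) ->
  bihomog i (j + (d.+1 * n)%:Z) (aug_num v).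
Proof.
move=> hv; have dn : (d <= d * n)%N by rewrite leq_pmulr.
have -> : j + (d.+1 * n)%:Z = (d * n - d)%:Z by rewrite mulSn; lia.
split.
  rewrite /= rpred_sum // => a _; rewrite rpredZ // dhomogX /=.
  apply/eqP; have := mono_le_cst n_gt0 a (leqnn _) => /submK/(congr1 mdeg).
  by rewrite mdegD mdeg_mono // mdeg_cst; lia.
move=> m; rewrite raddf_sum /=; elim/big_ind: _ => [|p q|a _].
- exact: homz0.
- exact: homzD.
- by rewrite mcoeffZ mcoeffX; apply: homz_coef.
Qed.

Lemma aug_val_part i v : (forall a, homz i (v 0 a)) -> @bipart _ _ LC i j (aug_val v).
Proof.
move=> hv; exists (Cocycle (topcochain_cocycle (@yvar K n) (qcyc l r (aug_num v)) d.+1)) => // A.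
have [->|AT] := eqVneq A (finset.setTfor 'I_n).
  exists d.+1, (qcyc l r (aug_num v)); split.
    exists (aug_num v) => //; rewrite cardsT card_ord.
    exact: aug_num_bihomog.
  by rewrite /= /topcochain eqxx.
exists 0%N, 0; split.
  exists 0; last by rewrite -/(qcyc l r 0) qcyc0.
  by split=> [|m]; rewrite ?mcoeff0; exact: homz0.
by rewrite /= /topcochain (negPf AT) frac0.
Qed.

Lemma aug_val_sum (I : Type) (s : seq I) (F : I -> 'rV[S]_(N d)) :
  aug_val (\sum_(i <- s) F i) = \sum_(i <- s) aug_val (F i).
Proof.
elim: s => [|i s IH]; first by rewrite !big_nil aug_val0.
by rewrite !big_cons -[F i]scale1r aug_valZD IH mpolyC1 !scale1r.
Qed.

(** A bihomogeneous cocycle is a fraction on the full set of variables; the y-degree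
    of its numerator is fixed by j, and a negative one forces the zero class. *)
Lemma part_aug_val i z : @bipart _ _ LC i j z ->
  exists2 v : 'rV[S]_(N d), (forall a, homz i (v 0 a)) & z = aug_val v.
Proof.
move=> [c hc ->]; have [t [x [[p [pb pa] ->] cE]]] := hc (finset.setTfor 'I_n).
exists (residue d p t).
  by move=> a; rewrite mxE; case: ifP => _; [exact: pa | exact: homz0].
rewrite (topclassP cE) -/(cls l r p t).
move: pb; rewrite cardsT card_ord.
have [[k kE]|[k kE]] : (exists k : nat, j + (t * n)%:Z = k%:Z) \/
    exists k, j + (t * n)%:Z = Negz k.
- by case: (j + (t * n)%:Z) => k; [left | right]; exists k.
- rewrite kE => hp; apply: cls_residue hp _ => //; lia.
- by rewrite kE => /eqP->; rewrite cls0 residue0 aug_val0.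
Qed.

Lemma aug_component v : @component_pred K n LC j (aug_val v).
Proof.
have [M vM] := vpart_bound v; apply/asboolP.
exists [seq aug_val (vpart (nat_of_ord e) v) | e <- index_enum 'I_M].
  move=> _ /mapP[e _ ->]; exists (e : nat)%:Z; apply: aug_val_part => a /=.
  exact: vpart_homog.
by rewrite big_map {1}(vpart_sum vM) aug_val_sum.
Qed.

Definition aug v : graded_component LC j :=
  @Component K n LC j _ (aug_component v).

Lemma aug_linear : linear aug.
Proof. by move=> a u v; apply: val_inj; apply: aug_valZD. Qed.

HB.instance Definition _ := GRing.isLinear.Build S 'rV[S]_(N d)
  (graded_component LC j) _ aug aug_linear.

Lemma aug_eq0 v : aug v = 0 <-> exists w, v = w *m G.
Proof.
rewrite -(aug_val_eq0 n_gt0); split=> [/(congr1 val)//|e].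
exact: val_inj.
Qed.

Lemma aug_surj x : exists v, aug v = x.
Proof.
have /asboolP[s hs xE] := valP x.
have {hs} : exists v, \sum_(z <- s) z = aug_val v.
  elim: s hs {xE} => [|z s IH] hs; first by exists 0; rewrite big_nil aug_val0.
  have [|v vE] := IH; first by move=> y ys; apply: hs; rewrite inE ys orbT.
  have [|i /part_aug_val[u _ uE]] := hs z; first by rewrite inE eqxx.
  exists (u + v); rewrite big_cons vE uE -[u in RHS]scale1r aug_valZD mpolyC1 scale1r.
  by [].
by move=> [v vE]; exists v; apply: val_inj; rewrite /= -vE -xE.
Qed.

Lemma aug_part_gpart i x : @gpart _ (graded_component LC j) i x ->
  exists2 v : 'rV[S]_(N d), (forall a, homz i (v 0 a)) & x = aug v.
Proof.
by move=> /part_aug_val[v hv vE]; exists v => //; apply: val_inj.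
Qed.

Lemma aug_gpart i v : (forall a, homz i (v 0 a)) ->
  @gpart _ (graded_component LC j) i (aug v).
Proof. exact: aug_val_part. Qed.

End GradedComponent.

(** * The multiplicity *)
Lemma poly_eventually0 (p : {poly rat}) (i0 : int) :
  (forall i : int, i0 <= i -> p.[i%:~R] = 0) -> p = 0.
Proof.
move=> p0; apply/eqP; apply: contraT => pn0.
pose rs : seq rat := [seq (i0 + k%:Z)%:~R | k <- iota 0 (size p)].
have rsp : all (root p) rs.
  apply/allP => _ /mapP[k _ ->]; apply/eqP; apply: p0.
  by rewrite lerDl.
have rsu : uniq rs.
  rewrite map_inj_uniq ?iota_uniq // => x y /intr_inj /addrI.
  by case.
by have := max_poly_roots pn0 rsp rsu; rewrite size_map size_iota ltnn.
Qed.

Section FiniteLength.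
Variables (K : fieldType) (n : nat) (M : gradedModule {mpoly K[n]}).

Lemma has_dim_zero (V : lmodType {mpoly K[n]}) (U : set V) :
  (forall x, U x -> x = 0) -> has_dim U 0.
Proof.
move=> U0; exists (fun _ => 0); split=> [[]//|c _ []//|x /U0 ->].
by exists (fun _ => 0); rewrite big_ord0.
Qed.

Lemma multiplicity_finite_length (i0 : int) (e : nat) :
  (forall i x, i0 <= i -> gpart i x -> x = 0 :> M) ->
  has_dim [set: M] e -> multiplicity M = e%:R.
Proof.
move=> M0 he; apply: xget_unique.
  exists 0; last by rewrite eqxx; exists e.
  exists i0 => i i0i; exists 0%N; last by rewrite horner0.
  by apply: has_dim_zero => x; apply: M0.
move=> e' [p [i1 hp]].
have -> : p = 0.
  apply: (@poly_eventually0 _ (Order.max i0 i1)) => i; rewrite ge_max => /andP[h0 h1].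
  have [k hk <-] := hp i h1.
  rewrite (has_dim_uniq hk (has_dim_zero _)) // => x; exact: M0.
by rewrite eqxx => -[k hk ->]; rewrite (has_dim_uniq hk he).
Qed.

End FiniteLength.

Section Length.
Variables (K : fieldType) (n : nat).
Hypothesis n_gt0 : (0 < n)%N.
Hypothesis charK : [pchar K] =i pred0.
Local Notation S := {mpoly K[n]}.
Local Notation N := (nmon n).
Variables (l : 'I_n -> K) (d r : nat).
Hypothesis l_neq0 : forall i, l i != 0.
Local Notation H :=
  (graded_component (local_cohomology (cyclic_module (flambda l ^+ r)) n) (- (n + d)%:Z)).
Local Notation G := (presentation l d r).
Local Notation aug := (@aug K n n_gt0 l d r).

Lemma aug_vanish e (v : 'rV[S]_(N d)) : (d + r <= e)%N -> vhomog e v -> aug v = 0.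
Proof.
move=> de hv; apply/aug_eq0.
exact: (presentation_surj n_gt0 charK l_neq0 de hv).
Qed.

Lemma gpart_vanish i (x : H) : (d + r)%:Z <= i -> gpart i x -> x = 0.
Proof.
move=> di /(aug_part_gpart n_gt0)[v hv ->].
by case: i di hv => // e de hv; apply: aug_vanish hv.
Qed.

(** Vectors of degree less than d + r already span the cokernel, and those among
    them that die are the images, by the injective map G, of the vectors of degree
    less than d. *)
Lemma length_component : exists2 e, has_dim [set: H] e &
  (N (d + r) * 'C(d + n.-1, n) + e = N d * 'C(d + r + n.-1, n))%N.
Proof.
have Ginj v : vbound d v -> v *m G = 0 -> v = 0.
  move=> lv vG; rewrite (vpart_sum lv) big1 // => e _.
  apply: (presentation_inj n_gt0 charK l_neq0 (e := e)) (vpart_homog e v) _.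
    exact: ltnW.
  exact: (vpart_ker (@presentation_homog K n l d r)).
have [k [k' [kk' hk hk']]] := has_dim_linear (mulmxr G)
  (ksub_vbound K n _ d) (has_dim_vbound K n_gt0 (N (d + r)) d).
have k0 : k = 0%N.
  by apply: has_dim_uniq hk (has_dim_zero _) => x [lx /= xG]; apply: Ginj.
have [c [e [ce hc he]]] := has_dim_linear aug
  (ksub_vbound K n _ (d + r)) (has_dim_vbound K n_gt0 (N d) (d + r)).
exists e.
  apply: has_dim_ext he => x /=; split=> // _.
  have [v <-] := aug_surj n_gt0 x; have [M vM] := vpart_bound v.
  exists (\sum_(i < d + r) vpart i v).
    by apply: vbound_sum => i; apply: vhomog_vbound (vpart_homog _ _) _.
  have vM' : vbound (d + r + M) v by move=> t; rewrite (leq_trans (vM t)) ?leq_addl.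
  rewrite {1}(vpart_sum vM') big_split_ord linearD /= -[RHS]addr0; congr (_ + _).
  rewrite linear_sum big1 // => i _.
  by apply: aug_vanish (vpart_homog _ _); rewrite leq_addr.
suff -> : (N (d + r) * 'C(d + n.-1, n))%N = c by [].
rewrite -kk' k0 add0n; apply: has_dim_uniq hk' _; apply: has_dim_ext hc => v /=.
have hG := @presentation_homog K n l d r.
split=> [[hv /aug_eq0[w vw]]|[w hw ->]].
  exists (\sum_(e < d) vpart e w).
    by apply: vbound_sum => i; apply: vhomog_vbound (vpart_homog _ _) _.
  have hv' : vbound (r + d) v by rewrite addnC.
  rewrite (vpart_sum hv') big_split_ord /= big1 ?add0r => [|i _].
    by rewrite mulmx_suml; apply: eq_bigr => i _; rewrite vw addnC vpart_mul.
  by rewrite vw (vpart_mul_lt hG).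
split; last by apply/aug_eq0; exists w.
rewrite (vpart_sum hw) mulmx_suml; apply: vbound_sum => i.
by apply: vhomog_vbound (vhomog_mul hG (vpart_homog _ _)) _; rewrite ltn_add2r.
Qed.

Lemma multiplicity_component : (0 < r)%N ->
  multiplicity H = r%:R * (d + r + n.-1)`!%:R * (N d)%:R / (n`!%:R * (d + r)`!%:R).
Proof.
move=> r0; have [e he eE] := length_component.
rewrite (multiplicity_finite_length gpart_vanish he).
have bn q : (n * 'C(q + n.-1, n) = q * N q)%N.
  by rewrite nmonE; have := mul_bin_left (q + n.-1) n.-1; rewrite prednK // addnK.
have nE : (n%:R * e%:R = r%:R * (N d)%:R * (N (d + r))%:R :> rat).
  rewrite -!natrM; congr _%:R; have := congr1 (muln n) eE.
  rewrite mulnDr ![(n * (N _ * _))%N]mulnCA !bn; nia.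
have N1 : (d + r + n.-1)`! = (N (d + r) * n.-1`! * (d + r)`!)%N.
  by rewrite nmonE -mulnA -[LHS](@bin_fact _ n.-1) ?leq_addl // addnK.
have n0 : n%:R != 0 :> rat by rewrite pnatr_eq0 -lt0n.
have D0 : ((d + r)`!)%:R != 0 :> rat by rewrite pnatr_eq0 -lt0n fact_gt0.
have f0 : (n.-1)`!%:R != 0 :> rat by rewrite pnatr_eq0 -lt0n fact_gt0.
have nf : n`! = (n * n.-1`!)%N by case: (n) n_gt0 => // n' _; rewrite factS.
apply: (mulfI n0); rewrite nE N1 nf !natrM; field.
by rewrite n0 D0 f0.
Qed.

End Length.

(** * Betti numbers and multiplicity of the graded component *)
Section BettiNumbers.
Variables (K : fieldType) (n : nat).
Hypothesis n_ge2 : (2 <= n)%N.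
Hypothesis charK : [pchar K] =i pred0.
Local Notation N := (nmon n).
Variables (l : 'I_n -> K) (d r : nat).
Hypothesis l_neq0 : forall i, l i != 0.
Hypothesis r_gt0 : (0 < r)%N.
Local Notation H :=
  (graded_component (local_cohomology (cyclic_module (flambda l ^+ r)) n) (- (n + d)%:Z)).

Let n_gt0 : (0 < n)%N := ltnW n_ge2.

Lemma aug_delta t : @gpart _ H 0 (aug n_gt0 l r (delta_mx 0 t : 'rV_(N d))).
Proof.
apply: aug_gpart => a; rewrite mxE /=.
by case: (a == t); [exact: dhomog1 | exact: rpred0].
Qed.

Lemma betti_component : [/\ betti H 0 = N d, betti H 1 = N (d + r) &
  forall i, (2 <= i <= n)%N -> (betti H i)%:R =
    (r * n.-1`! * N d * N (d + r))%:R
     / ((i - 2)`! * (n - i)`! * (d + r + i).-1 * (d + i).-1)%:R :> rat].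
Proof.
pose F := pure_resolution n_gt0 charK (@presentation_homog K n l d r)
  (@presentation_inj K n n_gt0 charK l d r l_neq0)
  (@presentation_surj K n n_gt0 charK l d r l_neq0)
  aug_delta (@aug_surj K n n_gt0 l d r) (@aug_eq0 K n n_gt0 l d r).
have mF : minimal_resolution F by exact: pure_resolution_minimal.
split; rewrite ?(betti_minimal _ mF) //.
move=> i i2n; rewrite (betti_minimal _ mF).
apply: (pure_betti (B := frank F) n_ge2) => // s.
exact: pure_resolution_euler.
Qed.

End BettiNumbers.

Theorem corollary4p8 (K : fieldType) (hK : [pchar K] =i pred0)
    (n : nat) (hn : (2 <= n)%N) (r : nat) (hr : (1 <= r)%N) :
  exists V : set ('I_n -> K),
    [/\ zariski_open V, (exists l, V l) &
      forall l, V l -> forall j : int, j <= - n%:Z ->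
        let R := cyclic_module (flambda l ^+ r) in
        let H := graded_component (local_cohomology R n) j in
        [/\ betti H 0 = 'C(absz (- j - 1)%R, absz (- n%:Z - j)%R),
            betti H 1 = 'C(absz (- j + r%:Z - 1)%R, absz (- n%:Z - j + r%:Z)%R),
            forall i : nat, (2 <= i <= n)%N ->
              (betti H i)%:R =
                - (r%:R * (n - 1)`!%:R * (betti H 0)%:R * (betti H 1)%:R)
                / ((i - 2)`!%:R * (n - i)`!%:R
                   * (- n%:Z - j + r%:Z + i%:Z - 1)%:~R
                   * (n%:Z + j - i%:Z + 1)%:~R) :> rat
          & multiplicity H =
              r%:R * (absz (- j + r%:Z - 1)%R)`!%:R * (betti H 0)%:R
              / (n`!%:R * (absz (- n%:Z - j + r%:Z)%R)`!%:R)]].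
Proof.
have n_gt0 : (0 < n)%N by exact: ltnW.
exists (fun l => forall i, l i != 0); split.
- exists (fun p => p = \prod_i 'X_i) => l; split=> [l0|[p -> pl] i].
    exists (\prod_i 'X_i) => //; rewrite rmorph_prod; apply/prodf_neq0 => i _.
    by rewrite /= mevalXU.
  move: pl; rewrite rmorph_prod => /prodf_neq0/(_ i isT).
  by rewrite /= mevalXU.
- by exists (fun _ => 1) => i; exact: oner_neq0.
move=> l l_neq0 j jn R H.
(* d is the y-degree of the inverse polynomials that live in degree j. *)
have [d jE] : exists d : nat, j = - (n + d)%:Z by exists (absz (- n%:Z - j)%R); lia.
rewrite {}/H {}/R {jn}jE.
have [b0 b1 bi] := @betti_component K n hn hK l d r l_neq0 hr.
have e1 : absz (- (- (n + d)%:Z) - 1)%R = (d + n.-1)%N by lia.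
have e2 : absz (- n%:Z - - (n + d)%:Z)%R = d by lia.
have e3 : absz (- (- (n + d)%:Z) + r%:Z - 1)%R = (d + r + n.-1)%N by lia.
have e4 : absz (- n%:Z - - (n + d)%:Z + r%:Z)%R = (d + r)%N by lia.
split; rewrite ?b0 ?b1 ?e1 ?e2 ?e3 ?e4 //; last exact: multiplicity_component.
move=> i i2n; rewrite bi // subn1.
have -> : - n%:Z - - (n + d)%:Z + r%:Z + i%:Z - 1 = (d + r + i).-1%:Z by lia.
have -> : n%:Z + - (n + d)%:Z - i%:Z + 1 = - (d + i).-1%:Z by lia.
by rewrite mulrNz mulrN invrN mulrNN !natrM.
Qed.
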